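(* For every integer $d\ge 0$ there is a constant $C_d>0$, depending only on $d$, and for every $d$ and every $B>0$ there is a constant $c_{d,B}>0$, depending only on $d$ and $B$, such that the following holds. Let $P(\zeta)$ be a polynomial in one complex variable of degree $d$, all of whose roots are in the disc $D\left(0,\frac12\right)$ and whose leading coefficient has modulus $A\ge C_d$. Let $\varphi\in C^2(\overline{\mathbb{D}};\mathbb{R})$ be such that $$B^{-1}|P(\zeta)|^2\le\Delta\varphi(\zeta)\le B|P(\zeta)|^2\qquad\forall\zeta\in\mathbb{D}.$$ Then $$\int_{\mathbb{D}}\left|\frac{\partial w}{\partial\overline z}\right|^2e^{-2\varphi}+\int_{\mathbb{D}}\Delta\varphi\,|w|^2e^{-2\varphi}\ \ge\ c_{d,B}\,A^{\frac{2}{d+1}}\int_{\mathbb{D}}|w|^2e^{-2\varphi}$$ for all $w\in C^1(\overline{\mathbb{D}})$ (complex-valued).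
   Context: $\mathbb{D}$ is the open unit disc in $\mathbb{C}$, $D(z,r)$ is the open disc of center $z$ and radius $r$, $\Delta$ is the Laplacian, $\frac{\partial}{\partial\overline z}=\frac12\left(\frac{\partial}{\partial x}+i\frac{\partial}{\partial y}\right)$, and integrals are with respect to Lebesgue measure. *)

(* Defs.v *)
From HB Require Import structures.
From mathcomp Require Import all_boot all_order all_algebra.
From mathcomp Require Import complex.
From mathcomp Require Import all_classical all_reals all_analysis.

Set Implicit Arguments.
Unset Strict Implicit.
Unset Printing Implicit Defensive.

Import Order.TTheory GRing.Theory Num.Theory.
Import numFieldNormedType.Exports.

Local Open Scope classical_set_scope.
Local Open Scope ring_scope.
Local Open Scope complex_scope.

(* The complex plane as a measure space and a normed space is [R * R];
   [R[i]] is its field structure, and [zeta] is the identification. *)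
Section Plane.
Variable R : realType.

Definition zeta (p : R * R) : R[i] := p.1 +i* p.2.

(* [`|z|] on [R[i]] takes values in [R[i]]; this is the same modulus in [R]. *)
Definition cabs (z : R[i]) : R := ComplexField.Normc.normc z.

(* Not stated with [ball], because the library norm on [R * R] is the maximum
   norm. *)
Definition disc : set (R * R) := [set p | cabs (zeta p) < 1].

Definition cdisc : set (R * R) := [set p | cabs (zeta p) <= 1].

Definition ex : R^o * R^o := (1, 0).
Definition ey : R^o * R^o := (0, 1).

Definition dx (f : R * R -> R) (p : R * R) : R :=
  'D_ex (f : R^o * R^o -> R^o) p.

Definition dy (f : R * R -> R) (p : R * R) : R :=
  'D_ey (f : R^o * R^o -> R^o) p.

Definition laplacian (f : R * R -> R) (p : R * R) : R :=
  dx (dx f) p + dy (dy f) p.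

(* [f] is of class C^k on the closed disc: continuous there, with all partial
   derivatives up to order [k] existing in the open disc and extending
   continuously to the closed disc.  The functions [gx] and [gy] are these
   extensions of the first partial derivatives. *)
Fixpoint Cclosed (k : nat) (f : R * R -> R) : Prop :=
  {within cdisc, continuous f} /\
  if k is k'.+1 then
    (forall p, disc p ->
       derivable (f : R^o * R^o -> R^o) p ex /\
       derivable (f : R^o * R^o -> R^o) p ey) /\
    (exists gx, Cclosed k' gx /\ {in disc, dx f =1 gx}) /\
    (exists gy, Cclosed k' gy /\ {in disc, dy f =1 gy})
  else True.

Definition repart (w : R * R -> R[i]) (p : R * R) : R := complex.Re (w p).
Definition impart (w : R * R -> R[i]) (p : R * R) : R := complex.Im (w p).

Definition Cclosed_complex (k : nat) (w : R * R -> R[i]) : Prop :=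
  Cclosed k (repart w) /\ Cclosed k (impart w).

Definition dxc (w : R * R -> R[i]) (p : R * R) : R[i] :=
  dx (repart w) p +i* dx (impart w) p.

Definition dyc (w : R * R -> R[i]) (p : R * R) : R[i] :=
  dy (repart w) p +i* dy (impart w) p.

Definition dbar (w : R * R -> R[i]) (p : R * R) : R[i] :=
  2^-1 * (dxc w p + (0 +i* 1) * dyc w p).

Definition area :
    {measure set (measurableTypeR R * measurableTypeR R) -> \bar R} :=
  ((@lebesgue_measure R) \x (@lebesgue_measure R))%E.

End Plane.

Arguments disc : clear implicits.
Arguments cdisc : clear implicits.
Arguments area : clear implicits.

(* Main.v *)
Require Import Defs.
From HB Require Import structures.
From mathcomp Require Import all_boot all_order all_algebra.
From mathcomp Require Import complex ring lra.
From mathcomp Require Import all_classical all_reals all_analysis.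
From mathcomp Require Import measurable_realfun lebesgue_integral_under.
Set Implicit Arguments.
Unset Strict Implicit.
Unset Printing Implicit Defensive.
Import Order.TTheory GRing.Theory Num.Theory.
Import numFieldNormedType.Exports.
Local Open Scope classical_set_scope.
Local Open Scope ring_scope.

(** Write [u = chi w e^(-phi)] with a cutoff [chi] supported in a square inside
    the disc, [g = |u|^2], and [4 |D u|^2] for the energy of
    [D = dbar + (dbar phi)].  With the magnetic derivatives
    [X = d_x + i phi_y], [Y = d_y - i phi_x] one has pointwise
    [4 |D u|^2 + (Delta phi) g = |X u|^2 + |Y u|^2 - 2 J + div (g grad phi)],
    where [J] is the Jacobian of [u].  The terms [J] and [div] integrate to
    zero, so the left-hand side controls [|X u|^2], hence [d_x |u|].

    What remains is a one-dimensional uncertainty principle.  Let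
    [k = A^(1/(d+1))] and [F(x) = k sum_j atan (k (x - Re z_j))] over the roots
    [z_j].  Then [F' + |P|^2 >= k^2 / 2] everywhere: near some [Re z_j] because
    of [F'], and elsewhere because [|P| >= A k^(-d) = k].  Since [|F| = O(k)],
    integrating [d_x (F g)] and using Cauchy-Schwarz gives
    [k^2 / 4 * int g <= int |P|^2 g + O(1) int |X u|^2].

    The gradient of the cutoff contributes [O(1) |w|^2 e^(-2 phi)]: where [chi]
    is bounded below it is absorbed because [A] is large, and elsewhere the
    roots are far away, so that [|P|], hence [Delta phi], is large. *)

(** * Integrals over squares *)

Section SquareIntegrals.
Variable R : realType.
Local Notation plane := (measurableTypeR R * measurableTypeR R)%type.
Local Notation mu := (@lebesgue_measure R).

(** Measurability refers to the product sigma-algebra. An open set is the countable union of the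
    balls with rational centre and radius [n.+1%:R^-1] that it contains, and a ball of the maximum
    norm is a product of intervals. *)
Lemma open_plane_measurable (U : set (R * R)) :
  open U -> measurable (U : set plane).
Proof.
move=> oU.
pose F (q : rat * rat * nat) : set (R * R) :=
  ball (ratr q.1.1 : R, ratr q.1.2 : R) (q.2.+1%:R^-1 : R).
have -> : U = \bigcup_(q in [set q | F q `<=` U]) F q.
  rewrite predeqE => -[x y]; split=> [Uxy|[q /= + Fq]]; last exact.
  have /nbhs_ballP[e /= e0 eU] := open_nbhs_nbhs (conj oU Uxy).
  have [n ne] : exists n : nat, n.+1%:R^-1 < e / 2 :> R.
    have [n _ /(_ n (leqnn n)) h] := near_infty_natSinv_lt (PosNum (divr_gt0 e0 (ltr0n R 2))).
    by exists n.
  have n0 : 0 < n.+1%:R^-1 :> R by rewrite invr_gt0.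
  have sub_add (t : R) : t - n.+1%:R^-1 < t + n.+1%:R^-1.
    by move: n0; move: (n.+1%:R^-1 : R) => r r0; lra.
  have [qx /itvP qxP] := @rat_in_itvoo R _ _ (sub_add x).
  have [qy /itvP qyP] := @rat_in_itvoo R _ _ (sub_add y).
  have bq : ball (ratr qx : R, ratr qy : R) (n.+1%:R^-1 : R) (x, y).
    by split => /=; rewrite /ball /= ltr_distl; apply/andP; split;
      rewrite ?ltrBlDr ?qxP ?qyP// -ltrBlDr ?qxP ?qyP.
  exists (qx, qy, n) => //= z bz; apply: eU.
  rewrite (splitr e); apply: (@ball_triangle _ _ (ratr qx : R, ratr qy : R)).
    by apply: ball_sym; apply: le_ball bq; exact: ltW.
  by apply: le_ball bz; exact: ltW.
rewrite bigcup_mkcond; apply: countable_bigcupT_measurable => [|[[qx qy] n]]; first exact: countableP.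
case: ifP => // _.
rewrite (_ : F _ = ball (ratr qx : R) (n.+1%:R^-1 : R) `*` ball (ratr qy : R) (n.+1%:R^-1 : R)) //.
by apply: measurableX; apply: open_measurable; exact: ball_open.
Qed.

Lemma continuous_plane_measurable (D : set (R * R)) (f : R * R -> R) :
  measurable (D : set plane) -> (forall p, D p -> {for p, continuous f}) ->
  measurable_fun (D : set plane) f.
Proof.
move=> mD cf; apply: (measurability _ (RGenOpens.measurableE R)).
move=> _ [_ [a [b ->] <-]].
(* On [D] the preimage of an open interval agrees with its own interior, since [f] is continuous in
   the whole plane at the points of [D]. *)
rewrite (_ : _ `&` _ = D `&` (f @^-1` [set` `]a, b[])^°); last first.
  rewrite predeqE => p; split=> -[Dp] h; split => //.
    by apply: (cf p Dp); apply: open_nbhs_nbhs; split => //; exact: interval_open.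
  exact: (@interior_subset _ (f @^-1` [set` `]a, b[])).
by apply: measurableI => //; apply: open_plane_measurable; exact: open_interior.
Qed.

Variable s : R.

Definition square : set (R * R) := `[- s, s] `*` `[- s, s].

Lemma measurable_square : measurable (square : set plane).
Proof. by apply: measurableX; exact: measurable_itv. Qed.

Lemma square_bounded (f : R * R -> R) :
  (forall p, square p -> {for p, continuous f}) ->
  exists M : R, forall p, square p -> `|f p| <= M.
Proof.
move=> cf.
have cs : compact square by apply: compact_setX; exact: segment_compact.
have ws : {within square, continuous f}.
  apply: continuous_in_subspaceT => p /set_mem; exact: cf.
have /compact_bounded[M [_ mrt]] := continuous_compact ws cs.
exists (M + 1) => p sp; apply: (mrt (M + 1)); first by rewrite ltrDl.
by exists p.
Qed.

Lemma integrable_square (f : R * R -> R) :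
  (forall p, square p -> {for p, continuous f}) ->
  (area R).-integrable (square : set plane) (EFin \o f).
Proof.
move=> cf; apply: measurable_bounded_integrable.
- exact: measurable_square.
- rewrite /area/= product_measure1E; [|exact: measurable_itv..].
  by rewrite /= !lebesgue_measure_itv/=; case: ifP => _; rewrite ?mule0 // -EFinB -EFinM ltry.
- exact: continuous_plane_measurable measurable_square cf.
- have [M hM] := square_bounded cf.
  exists M; split; rewrite ?num_real// => N MN p sp.
  exact: le_trans (hM p sp) (ltW MN).
Qed.

Lemma continuous_slice1 (f : R * R -> R) (x y : R) :
  {for (x, y), continuous f} -> {for x, continuous (fun t => f (t, y))}.
Proof.
move=> cf; apply: (@continuous_comp _ _ _ (fun t => (t, y)) f) => //.
by apply: (@cvg_pair _ _ _ _ (nbhs x) (nbhs y)); [exact: cvg_id|exact: cvg_cst].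
Qed.

Lemma continuous_slice2 (f : R * R -> R) (x y : R) :
  {for (x, y), continuous f} -> {for y, continuous (fun t => f (x, t))}.
Proof.
move=> cf; apply: (@continuous_comp _ _ _ (fun t => (x, t)) f) => //.
by apply: (@cvg_pair _ _ _ _ (nbhs x) (nbhs y)); [exact: cvg_cst|exact: cvg_id].
Qed.

(** Fubini's theorem is applied on the whole plane to the extension of [f] by zero; here that
    extension is separated into two one-variable extensions. *)
Lemma patch_square (f : R * R -> R) (x y : R) :
  ((EFin \o f) \_ square) (x, y) =
  if x \in `[- s, s] then ((fun t => (f (x, t))%:E) \_ `[- s, s]) y else 0%E.
Proof.
rewrite !patchE; case: ifPn => [/set_mem [/= -> hy]|/negP h].
  by rewrite mem_set.
case: ifPn => // hx; rewrite memNset// => hy; apply: h; exact/mem_set.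
Qed.

Lemma integral_square_dydx (f : R * R -> R) :
  (forall p, square p -> {for p, continuous f}) ->
  (\int[area R]_(p in square) (f p)%:E =
   \int[mu]_(x in `[(- s)%R, s]) \int[mu]_(y in `[(- s)%R, s]) (f (x, y))%:E)%E.
Proof.
move=> cf.
have ipf : (area R).-integrable setT ((EFin \o f) \_ square).
  by apply/(integrable_mkcond _ measurable_square).1; exact: integrable_square.
rewrite integral_mkcond -(integral12_prod_meas1 ipf) [RHS]integral_mkcond.
apply: eq_integral => x _; rewrite /fubini_F.
under eq_integral do rewrite patch_square.
rewrite patchE; case: ifPn => xs.
  by rewrite [RHS]integral_mkcond; apply: eq_integral => y _; rewrite (set_mem xs).
rewrite (_ : (x \in `[- s, s]) = false) ?integral0//.
by apply/negbTE; apply: contra xs => ?; exact/mem_set.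
Qed.

Lemma integral_square_dxdy (f : R * R -> R) :
  (forall p, square p -> {for p, continuous f}) ->
  (\int[area R]_(p in square) (f p)%:E =
   \int[mu]_(y in `[(- s)%R, s]) \int[mu]_(x in `[(- s)%R, s]) (f (x, y))%:E)%E.
Proof.
move=> cf.
have ipf : (area R).-integrable setT ((EFin \o f) \_ square).
  by apply/(integrable_mkcond _ measurable_square).1; exact: integrable_square.
rewrite integral_square_dydx// -[LHS]integral_square_dydx//.
rewrite integral_mkcond -(integral21_prod_meas1 ipf) [RHS]integral_mkcond.
apply: eq_integral => y _; rewrite /fubini_G.
rewrite patchE; case: ifPn => ys.
  rewrite [RHS]integral_mkcond; apply: eq_integral => x _.
  rewrite patch_square !patchE; case: ifPn => xs; last first.
    by rewrite ifN//; apply: contra xs => /set_mem.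
  by rewrite ys mem_set.
rewrite integral0_eq// => x _.
rewrite patch_square; case: ifPn => // _.
by rewrite patchE ifN.
Qed.

End SquareIntegrals.

(** * Exact terms integrate to zero *)

Section Jacobian.
Variable R : realType.
Local Notation mu := (@lebesgue_measure R).

Lemma is_derive_continuous (f : R -> R) (x l : R) :
  is_derive x 1 f l -> {for x, continuous f}.
Proof. by move=> [df _]; apply: differentiable_continuous; apply/derivable1_diffP. Qed.

Lemma continuous_within_itv (f : R -> R) (a b : R) :
  (forall x, x \in `[a, b] -> {for x, continuous f}) ->
  {within `[a, b], continuous f}.
Proof. by move=> cf; apply: continuous_in_subspaceT => x /set_mem /= /cf. Qed.

Lemma integral_is_derive (F f : R -> R) (a b : R) : a < b ->
  (forall x, x \in `[a, b] -> is_derive x 1 F (f x)) ->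
  (forall x, x \in `[a, b] -> {for x, continuous f}) ->
  (\int[mu]_(x in `[a, b]) (f x)%:E = (F b - F a)%:E)%E.
Proof.
move=> ab dF cf; rewrite EFinB; apply: continuous_FTC2 => //.
- exact: continuous_within_itv.
- split.
  + by move=> x /subset_itv_oo_cc /dF[].
  + apply: cvg_at_right_filter.
    by apply: is_derive_continuous (dF a _); rewrite in_itv/= lexx ltW.
  + apply: cvg_at_left_filter.
    by apply: is_derive_continuous (dF b _); rewrite in_itv/= lexx ltW.
- by move=> x /subset_itv_oo_cc /dF df; rewrite derive1E derive_val.
Qed.

Lemma integrable_itv (f : R -> R) (a b : R) :
  (forall x, x \in `[a, b] -> {for x, continuous f}) ->
  mu.-integrable `[a, b] (EFin \o f).
Proof.
move=> cf; apply: continuous_compact_integrable; first exact: segment_compact.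
exact: continuous_within_itv.
Qed.

(** * Integrals of partial derivatives over a square *)

Section Divergence.
Variables (s : R) (f f' : R * R -> R).
Hypotheses (s0 : 0 < s) (cf' : forall p, square s p -> {for p, continuous f'}).

(** The fundamental theorem of calculus makes the integral over each horizontal slice vanish;
    Fubini's theorem does the rest. *)
Lemma integral_square_dx0 :
  (forall p, square s p -> is_derive p.1 1 (fun t => f (t, p.2)) (f' p)) ->
  (forall y, f (s, y) = 0) -> (forall y, f (- s, y) = 0) ->
  (\int[area R]_(p in square s) (f' p)%:E = 0)%E.
Proof.
move=> df fs fNs; rewrite integral_square_dxdy//; apply: integral0_eq => y sy.
have := @integral_is_derive (fun t => f (t, y)) (fun t => f' (t, y)) (- s) s.
rewrite fs fNs subrr; apply.
- by rewrite gtrN.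
- by move=> x sx; apply: (df (x, y)).
- by move=> x sx; apply: continuous_slice1; exact: cf'.
Qed.

Lemma integral_square_dy0 :
  (forall p, square s p -> is_derive p.2 1 (fun t => f (p.1, t)) (f' p)) ->
  (forall x, f (x, s) = 0) -> (forall x, f (x, - s) = 0) ->
  (\int[area R]_(p in square s) (f' p)%:E = 0)%E.
Proof.
move=> df fs fNs; rewrite integral_square_dydx//; apply: integral0_eq => x sx.
have := @integral_is_derive (fun t => f (x, t)) (fun t => f' (x, t)) (- s) s.
rewrite fs fNs subrr; apply.
- by rewrite gtrN.
- by move=> y sy; apply: (df (x, y)).
- by move=> y sy; apply: continuous_slice2; exact: cf'.
Qed.

End Divergence.

(** The derivatives are those of one-variable slices, so that calculus on the line applies directly.
    Continuity is meant in the whole plane, also at boundary points of [D]. *)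
Definition C1_on (D : set (R * R)) (f fx fy : R * R -> R) :=
  forall p, D p -> [/\ {for p, continuous f}, {for p, continuous fx},
    {for p, continuous fy},
    is_derive p.1 1 (fun t => f (t, p.2)) (fx p) &
    is_derive p.2 1 (fun t => f (p.1, t)) (fy p)].

(** The difference quotient in the first variable, completed at [h = 0] by the derivative:
    differentiation at [x] becomes continuity in [h] at 0. *)
Definition slope (f f' : R * R -> R) (x h y : R) : R :=
  if h == 0 then f' (x, y) else (f (x + h, y) - f (x, y)) / h.

Section Slope.
Variables (s : R) (f fx fy : R * R -> R) (x y : R).
Hypotheses (fC1 : C1_on (square s) f fx fy) (sy : y \in `[- s, s]).

Lemma slope_continuous (h : R) : x \in `[- s, s] -> x + h \in `[- s, s] ->
  {for h, continuous (fun t => slope f fx x t y)}.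
Proof.
move=> sx sxh; have [h0|h0] := eqVneq h 0.
  have [_ _ _ [df dfE] _] := fC1 (conj sx sy : square s (x, y)).
  rewrite h0; apply/continuous_withinNx.
  rewrite {2}/slope eqxx -dfE; apply: cvg_trans df.
  apply: near_eq_cvg; near=> t.
  rewrite /slope ifF; last by apply/negbTE; near: t; exact: nbhs_dnbhs_neq.
  by rewrite /= /GRing.scale /= mulr1 (addrC t) mulrC.
have cq : {for h, continuous (fun t => (f (x + t, y) - f (x, y)) / t)}.
  apply: cvgM; last exact: cvgV.
  apply: cvgB; last exact: cvg_cst.
  have [cf _ _ _ _] := fC1 (conj sxh sy : square s (x + h, y)).
  apply: (@continuous_comp _ _ _ (fun t => x + t) (fun t => f (t, y))).
    by apply: cvgD; [exact: cvg_cst|exact: cvg_id].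
  exact: continuous_slice1.
rewrite /prop_for /continuous_at {2}/slope (negbTE h0).
apply: cvg_trans cq; apply: near_eq_cvg; near=> t.
rewrite /slope ifF//; apply/negbTE; near: t.
exact: (cvgr_neq0 _ cvg_id).
Unshelve. all: by end_near. Qed.

(** By the mean value theorem the quotient is a value of [fx]. The bound is uniform in [h] and
    serves as domination under the integral sign. *)
Lemma slope_bounded (h M : R) : (forall p, square s p -> `|fx p| <= M) ->
  x \in `[- s, s] -> x + h \in `[- s, s] -> `|slope f fx x h y| <= M.
Proof.
move=> hM sx sxh; rewrite /slope; case: ifPn => [_|h0]; first exact: (hM (x, y)).
have mvt (a b : R) : a \in `[- s, s] -> b \in `[- s, s] -> a <= b ->
    exists2 c, c \in `[- s, s] & f (b, y) - f (a, y) = fx (c, y) * (b - a).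
  move=> sa sb ab.
  have sub (z : R) : z \in `[a, b] -> z \in `[- s, s].
    move: sa sb; rewrite !in_itv/= => /andP[sa _] /andP[_ sb] /andP[az zb].
    by rewrite (le_trans sa az) (le_trans zb sb).
  have := @MVT_segment _ (fun t => f (t, y)) (fun t => fx (t, y)) a b ab.
  case.
  - move=> z /subset_itv_oo_cc /sub sz.
    by have [_ _ _ + _] := fC1 (conj sz sy : square s (z, y)).
  - apply: continuous_within_itv => z /sub sz.
    have [cf _ _ _ _] := fC1 (conj sz sy : square s (z, y)).
    exact: continuous_slice1.
  - by move=> c /sub sc ->; exists c.
have [c sc cE] : exists2 c, c \in `[- s, s] &
    f (x + h, y) - f (x, y) = fx (c, y) * h.
  have [h1|h1] := leP x (x + h).
    by have [c sc ->] := mvt _ _ sx sxh h1; exists c => //; rewrite addrAC subrr add0r.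
  have [c sc cE] := mvt _ _ sxh sx (ltW h1); exists c => //.
  by rewrite -opprB cE; ring.
by rewrite cE mulfK//; exact: (hM (c, y)).
Qed.

Lemma slope_continuousr (h : R) : x \in `[- s, s] -> x + h \in `[- s, s] ->
  {for y, continuous (slope f fx x h)}.
Proof.
move=> sx sxh.
have [cf cfx _ _ _] := fC1 (conj sx sy : square s (x, y)).
have [cfh _ _ _ _] := fC1 (conj sxh sy : square s (x + h, y)).
have [h0|h0] := eqVneq h 0.
  rewrite /slope h0 eqxx; exact: continuous_slice2.
rewrite /slope (negbTE h0); apply: cvgM; last exact: cvg_cst.
by apply: cvgB; [exact: continuous_slice2 cfh|exact: continuous_slice2 cf].
Qed.

End Slope.

(** * The integral of a Jacobian of C^1 functions *)

Section JacobianIntegral.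
Variables (s t : R) (a ax ay b bx by_ : R * R -> R).
Hypotheses (s0 : 0 < s) (st : s < t).
Hypotheses (aC1 : C1_on (square t) a ax ay) (bC1 : C1_on (square t) b bx by_).
Hypotheses (a_s : forall x, a (x, s) = 0) (a_Ns : forall x, a (x, - s) = 0).

Let sub_st (y : R) : y \in `[- s, s] -> y \in `[- t, t].
Proof. by move: st; rewrite !in_itv/= => ? /andP[? ?]; apply/andP; split; lra. Qed.

Let G (x : R) : R := \int[mu]_(y in `[(- s)%R, s]) (a (x, y) * by_ (x, y)).
Let J (p : R * R) : R := ax p * by_ p - ay p * bx p.
(** A discrete Jacobian: it equals [J (x, y)] at [h = 0], and for [h != 0] its integral is a
    difference quotient of [G]. *)
Let q (x h y : R) : R :=
  slope a ax x h y * by_ (x + h, y) - ay (x, y) * slope b bx x h y.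

Let integral_q_continuous (x : R) : x \in `]- t, t[ ->
  {for 0, continuous (fun h => \int[mu]_(y in `[(- s)%R, s]) q x h y)}.
Proof.
rewrite in_itv/= => /andP[tx xt].
have sx : x \in `[- t, t] by rewrite in_itv/=; apply/andP; split; lra.
(* The distance from [x] to the ends of [[- t, t]], so that [x + h] stays inside for [|h| < e]. *)
pose e := Num.min (x + t) (t - x).
have e0 : 0 < e by rewrite lt_min; apply/andP; split; lra.
have sxh h : h \in `]- e, e[ -> x + h \in `[- t, t].
  rewrite !in_itv/= => /andP[]; rewrite /e ltrNl !lt_min => /andP[h1 h2] /andP[h3 h4].
  by apply/andP; split; lra.
have ct (f f1 f2 : R * R -> R) : C1_on (square t) f f1 f2 ->
    exists M : R, forall p, square t p -> [/\ `|f1 p| <= M & `|f2 p| <= M].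
  move=> fC1.
  have [M1 h1] := @square_bounded R t f1 ltac:(by move=> p /fC1[]).
  have [M2 h2] := @square_bounded R t f2 ltac:(by move=> p /fC1[]).
  exists (Num.max M1 M2) => p tp; rewrite !le_max h1// h2// orbT; split => //.
have [Ma hMa] := ct _ _ _ aC1; have [Mb hMb] := ct _ _ _ bC1.
apply: (@continuity_under_integral R _ _ mu (q x) `[- s, s] _ (- e) e _ _
  (fun=> Ma * Mb + Ma * Mb)) => //=.
- move=> h he; apply: integrable_itv => y /sub_st sy.
  have sh := sxh _ he.
  apply: cvgB; apply: cvgM.
  + exact: (slope_continuousr aC1 sy sx sh).
  + have [_ _ c _ _] := bC1 (conj sh sy : square t (x + h, y)).
    exact: continuous_slice2 c.
  + have [_ _ c _ _] := aC1 (conj sx sy : square t (x, y)).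
    exact: continuous_slice2 c.
  + exact: (slope_continuousr bC1 sy sx sh).
- apply: aeW => y /= /sub_st sy h /set_mem he.
  have sh := sxh _ he.
  apply: cvgB; apply: cvgM.
  + exact: (slope_continuous aC1 sy sx sh).
  + have [_ _ c _ _] := bC1 (conj sh sy : square t (x + h, y)).
    apply: (@continuous_comp _ _ _ (fun h => x + h) (fun z => by_ (z, y))).
      by apply: cvgD; [exact: cvg_cst|exact: cvg_id].
    exact: continuous_slice1 c.
  + exact: cvg_cst.
  + exact: (slope_continuous bC1 sy sx sh).
- by apply: integrable_itv => y _; exact: cvg_cst.
- move=> h he; apply: aeW => y /= /sub_st sy.
  have sh := sxh _ he.
  rewrite (le_trans (ler_normB _ _))// !normrM lerD// ler_pM//.
  + by apply: (slope_bounded aC1) => // p /hMa[].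
  + by have [] := hMb _ (conj sh sy : square t (x + h, y)).
  + by have [] := hMa _ (conj sx sy : square t (x, y)).
  + by apply: (slope_bounded bC1) => // p /hMb[].
- by rewrite inE/= in_itv/= oppr_lt0 e0.
Qed.

(** The increment of [a * by_] contains [a] times the [y]-derivative of [b (x + h, y) - b (x, y)].
    Integration by parts in [y] moves that derivative onto [a], so no second derivative of [b] is
    ever formed. *)
Let integral_q (x h : R) : x \in `[- t, t] -> x + h \in `[- t, t] -> h != 0 ->
  \int[mu]_(y in `[(- s)%R, s]) q x h y = (G (x + h) - G x) / h.
Proof.
move=> sx sxh h0; apply: (mulIf h0); rewrite divfK//.
have cq y : y \in `[- s, s] -> {for y, continuous (q x h)}.
  move=> /sub_st sy.
  have [_ _ c1 _ _] := bC1 (conj sxh sy : square t (x + h, y)).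
  have [_ _ c2 _ _] := aC1 (conj sx sy : square t (x, y)).
  apply: cvgB; apply: cvgM.
  - exact: (slope_continuousr aC1 sy sx sxh).
  - exact: continuous_slice2 c1.
  - exact: continuous_slice2 c2.
  - exact: (slope_continuousr bC1 sy sx sxh).
have cG z y : z \in `[- t, t] -> y \in `[- s, s] ->
    {for y, continuous (fun y => a (z, y) * by_ (z, y))}.
  move=> sz /sub_st sy.
  have [ca _ _ _ _] := aC1 (conj sz sy : square t (z, y)).
  have [_ _ cb _ _] := bC1 (conj sz sy : square t (z, y)).
  by apply: cvgM; [exact: continuous_slice2 ca|exact: continuous_slice2 cb].
(* The [y]-derivative of [a (x, y) * (b (x + h, y) - b (x, y))], a product that vanishes at [y = s]
   and [y = - s] because [a] does. *)
pose D y := a (x, y) * (by_ (x + h, y) - by_ (x, y)) +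
            ay (x, y) * (b (x + h, y) - b (x, y)).
have cD y : y \in `[- s, s] -> {for y, continuous D}.
  move=> /sub_st sy.
  have [ca _ cay _ _] := aC1 (conj sx sy : square t (x, y)).
  have [cb _ cby _ _] := bC1 (conj sx sy : square t (x, y)).
  have [cbh _ cbyh _ _] := bC1 (conj sxh sy : square t (x + h, y)).
  apply: cvgD; apply: cvgM; try (apply: cvgB).
  - exact: continuous_slice2 ca.
  - exact: continuous_slice2 cbyh.
  - exact: continuous_slice2 cby.
  - exact: continuous_slice2 cay.
  - exact: continuous_slice2 cbh.
  - exact: continuous_slice2 cb.
have D0 : \int[mu]_(y in `[(- s)%R, s]) D y = 0.
  pose g y := a (x, y) * (b (x + h, y) - b (x, y)).
  suff DE : (\int[mu]_(y in `[(- s)%R, s]) (D y)%:E = (g s - g (- s)%R)%:E)%E.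
    by rewrite /Rintegral DE /g a_s a_Ns !mul0r subrr.
  apply: integral_is_derive.
  - by rewrite gtrN.
  - move=> y /sub_st sy.
    have [_ _ _ _ da] := aC1 (conj sx sy : square t (x, y)).
    have [_ _ _ _ db] := bC1 (conj sx sy : square t (x, y)).
    have [_ _ _ _ dbh] := bC1 (conj sxh sy : square t (x + h, y)).
    rewrite /= in da db dbh.
    apply: is_derive_eq; rewrite /D /GRing.scale/=; ring.
  - exact: cD.
have iq : mu.-integrable `[(- s)%R, s] (EFin \o q x h) by exact: integrable_itv.
have cGx := integrable_itv (cG x ^~ sx); have cGxh := integrable_itv (cG (x + h) ^~ sxh).
(* Adding the zero integral of [D] is what turns [q x h y * h] into the increment of [a * by_] from
   [x] to [x + h]. *)
rewrite -RintegralZr// -RintegralB// -[LHS]addr0 -D0 -RintegralD//.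
- by apply: eq_Rintegral => y _; rewrite /q /D /slope (negbTE h0); field.
- by apply: integrable_itv => y sy; apply: cvgM; [exact: cq|exact: cvg_cst].
- exact: integrable_itv.
Qed.

(** For small [h != 0] the difference quotient of [G] is the integral of [q x h], which by
    continuity tends to that of [q x 0]. Since [s < t], the derivative is two-sided even at the ends
    of [[- s, s]]. *)
Lemma jacobian_is_derive (x : R) : x \in `]- t, t[ ->
  is_derive x 1 G (\int[mu]_(y in `[(- s)%R, s]) J (x, y)).
Proof.
move=> tx; have := tx; rewrite in_itv/= => /andP[tx1 tx2].
have sx : x \in `[- t, t] by rewrite in_itv/= !ltW.
have cv : h^-1 *: ((G \o shift x) (h *: 1) - G x) @[h --> 0^'] -->
    \int[mu]_(y in `[(- s)%R, s]) J (x, y).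
  have := integral_q_continuous tx.
  move/continuous_withinNx.
  have -> : \int[mu]_(y in `[(- s)%R, s]) q x 0 y = \int[mu]_(y in `[(- s)%R, s]) J (x, y).
    by apply: eq_Rintegral => y _; rewrite /q /slope eqxx addr0.
  have cx : x + h @[h --> 0] --> nbhs x.
    by rewrite -{2}[x]addr0; apply: cvgD; [exact: cvg_cst|exact: cvg_id].
  have ntx : nbhs x [set` `[- t, t]].
    by apply: filterS (near_in_itvoo tx) => z; exact: subset_itv_oo_cc.
  apply: cvg_trans; apply: near_eq_cvg; near=> h.
  rewrite integral_q//.
  - by rewrite /= /GRing.scale /= mulr1 (addrC h) mulrC.
  - by near: h; apply: nbhs_dnbhs; apply: (cx [set` `[- t, t]]).
  - by near: h; exact: nbhs_dnbhs_neq.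
apply: DeriveDef; first by apply/cvg_ex; eexists; exact: cv.
exact: cvg_lim cv.
Unshelve. all: by end_near. Qed.

Let param_integral_continuous (f : R * R -> R) :
  (forall p, square t p -> {for p, continuous f}) ->
  {in `]- t, t[, continuous (fun x => \int[mu]_(y in `[(- s)%R, s]) f (x, y))}.
Proof.
move=> cf x tx; have [M hM] := square_bounded cf.
apply: (@continuity_under_integral R _ _ mu (fun x y => f (x, y)) `[- s, s] _ (- t) t
  _ _ (fun=> M)) => //=; last by rewrite inE.
- move=> z /subset_itv_oo_cc sz; apply: integrable_itv => y /sub_st sy.
  by apply: continuous_slice2; exact: cf.
- apply: aeW => y /= /sub_st sy z /set_mem /= /subset_itv_oo_cc sz.
  by apply: continuous_slice1; exact: cf.
- by apply: integrable_itv => y _; exact: cvg_cst.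
- move=> z /subset_itv_oo_cc sz; apply: aeW => y /= /sub_st sy.
  exact: (hM (z, y)).
Qed.

Hypotheses (sa : forall y, a (s, y) = 0) (sNa : forall y, a (- s, y) = 0).

(* For [C^2] functions [ax * by_ - ay * bx] is the divergence of
   [(a * by_, - a * bx)]; for [C^1] functions only the [x]-derivative of
   [\int a * by_ dy] makes sense. *)
Lemma integral_jacobian :
  (\int[area R]_(p in square s) (ax p * by_ p - ay p * bx p)%:E = 0)%E.
Proof.
have cJ p : square t p -> {for p, continuous J}.
  move=> tp; have [_ ? ? _ _] := aC1 tp; have [_ ? ? _ _] := bC1 tp.
  by apply: cvgB; apply: cvgM.
have sub_oo (x : R) : x \in `[- s, s] -> x \in `]- t, t[.
  by move: st; rewrite !in_itv/= => ? /andP[? ?]; apply/andP; split; lra.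
have sub2 p : square s p -> square t p.
  by case: p => x y [/= /sub_st ? /sub_st ?].
rewrite integral_square_dydx; last by move=> p /sub2; exact: cJ.
transitivity (\int[mu]_(x in `[(- s)%R, s])
    (\int[mu]_(y in `[(- s)%R, s]) J (x, y))%:E)%E.
  apply: eq_integral => x /set_mem /= /sub_oo /subset_itv_oo_cc sx.
  rewrite /Rintegral fineK//; apply: integrable_fin_num => //.
  by apply: integrable_itv => y /sub_st sy; apply: continuous_slice2; exact: cJ.
have -> : 0%E = (G s - G (- s))%:E.
  have G0 x : (forall y, a (x, y) = 0) -> G x = 0.
    by move=> ax0; rewrite /G /Rintegral integral0_eq// => y _; rewrite ax0 mul0r.
  by rewrite !G0// subrr.
apply: integral_is_derive.
- by rewrite gtrN.
- by move=> x /sub_oo; exact: jacobian_is_derive.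
- by move=> x /sub_oo; exact: param_integral_continuous.
Qed.

End JacobianIntegral.
End Jacobian.

(** * The polynomial and the barrier function *)

Section Polynomial.
Variable R : realType.
Implicit Types (z : R[i]) (r : seq R[i]) (k x : R).

Lemma sqr_cabs z : cabs z ^+ 2 = complex.Re z ^+ 2 + complex.Im z ^+ 2.
Proof. by case: z => x y; rewrite /cabs/= sqr_sqrtr// addr_ge0// sqr_ge0. Qed.

Lemma cabs_ge0 z : 0 <= cabs z.
Proof. by case: z => x y; rewrite /cabs/= sqrtr_ge0. Qed.

Lemma Re_le_cabs z : `|complex.Re z| <= cabs z.
Proof.
rewrite -(@ler_pXn2r _ 2) ?nnegrE ?cabs_ge0// sqr_cabs real_normK ?num_real//.
by rewrite lerDl sqr_ge0.
Qed.

Lemma Im_le_cabs z : `|complex.Im z| <= cabs z.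
Proof.
rewrite -(@ler_pXn2r _ 2) ?nnegrE ?cabs_ge0// sqr_cabs real_normK ?num_real//.
by rewrite lerDr sqr_ge0.
Qed.

Lemma cabs_prod r (f : R[i] -> R[i]) :
  cabs (\prod_(z <- r) f z) = \prod_(z <- r) cabs (f z).
Proof.
by rewrite (big_morph (@cabs R) (@ComplexField.Normc.normcM R) (@ComplexField.Normc.normc1 R)).
Qed.

Lemma cabs_horner_ge (P : {poly R[i]}) r (w : R[i]) (b : R) :
  P = lead_coef P *: \prod_(z <- r) ('X - z%:P) -> 0 <= b ->
  (forall z, z \in r -> b <= cabs (w - z)) ->
  cabs (lead_coef P) * b ^+ size r <= cabs P.[w].
Proof.
move=> PE b0 hb; rewrite [in leRHS]PE hornerZ horner_prod.
rewrite [cabs (_ * _)]ComplexField.Normc.normcM ler_wpM2l ?cabs_ge0//.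
rewrite (eq_bigr (fun z => w - z)); last by move=> z _; rewrite !hornerE.
rewrite -/(cabs _) cabs_prod; elim: r hb {PE} => [|z r IH] hb; first by rewrite big_nil expr0.
rewrite big_cons exprS ler_pM ?exprn_ge0//; first by apply: hb; rewrite mem_head.
by apply: IH => u ur; apply: hb; rewrite in_cons ur orbT.
Qed.

(** The function [F] of the idea above is [k] times this sum; with the factor [k] kept outside, the
    bound in [barrier_le] is independent of [k]. *)
Definition barrier k r x : R :=
  \sum_(z <- r) atan (k * (x - complex.Re z)).

Definition barrier' k r x : R :=
  \sum_(z <- r) k / (1 + (k * (x - complex.Re z)) ^+ 2).

Lemma is_derive_barrier k r x : is_derive x 1 (barrier k r) (barrier' k r x).
Proof.
rewrite /barrier /barrier'; elim: r => [|z r IH].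
  rewrite !big_nil (_ : (fun _ => _) = cst 0); first exact: is_derive_cst.
  by apply/funext => y; rewrite big_nil.
rewrite big_cons (_ : (fun _ => _) = (fun y => atan (k * (y - complex.Re z))) +
    (fun y => \sum_(z <- r) atan (k * (y - complex.Re z)))); last first.
  by apply/funext => y; rewrite big_cons.
apply: is_deriveD.
have : is_derive x 1 (fun y => k * (y - complex.Re z)) k.
  by apply: is_derive_eq; rewrite /GRing.scale/=; ring.
move=> /(@is_derive1_comp _ (@atan R) (fun y => k * (y - complex.Re z)) x _ _
  (is_derive1_atan _)).
by rewrite mulrC.
Qed.

Lemma barrier'_continuous k r : continuous (barrier' k r).
Proof.
rewrite /barrier'; elim: r => [|z r IH] x.
  rewrite (_ : (fun _ => _) = cst 0); first exact: cvg_cst.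
  by apply/funext => y; rewrite big_nil.
rewrite (_ : (fun _ => _) = (fun y => k / (1 + (k * (y - complex.Re z)) ^+ 2)) +
    (fun y => \sum_(z <- r) k / (1 + (k * (y - complex.Re z)) ^+ 2))); last first.
  by apply/funext => y; rewrite big_cons.
apply: cvgD; last exact: IH.
apply: cvgM; first exact: cvg_cst.
apply: cvgV; first by rewrite gt_eqF// ltr_pwDl ?sqr_ge0.
apply: cvgD; first exact: cvg_cst.
have cl : {for x, continuous (fun y => k * (y - complex.Re z))}.
  by apply: cvgM; [exact: cvg_cst|apply: cvgB; [exact: cvg_id|exact: cvg_cst]].
by apply: cvgM.
Qed.

Lemma barrier_le k r x : `|barrier k r x| <= (size r)%:R * pi.
Proof.
rewrite /barrier; elim: r => [|z r IH]; first by rewrite big_nil normr0 mul0r.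
rewrite big_cons (le_trans (ler_normD _ _))// -natr1 mulrDl addrC lerD//.
rewrite mul1r ler_norml; have := pi_ge0 R.
by have := atan_gtNpi2 (k * (x - complex.Re z));
  have := atan_ltpi2 (k * (x - complex.Re z)); move=> *; apply/andP; split; lra.
Qed.

Lemma barrier'_ge0 k r x : 0 <= k -> 0 <= barrier' k r x.
Proof. by move=> k0; apply: sumr_ge0 => z _; rewrite divr_ge0// addr_ge0// sqr_ge0. Qed.

(** The summand of [z] alone is at least [k / 2], and the others are nonnegative. *)
Lemma barrier'_ge k r x z : 0 < k -> z \in r -> `|x - complex.Re z| <= k^-1 ->
  k / 2 <= barrier' k r x.
Proof.
move=> k0 zr hx; rewrite /barrier' (big_rem z)//=.
rewrite -[leLHS]addr0 lerD//; last exact: barrier'_ge0 (ltW k0).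
rewrite ler_pM2l// lef_pV2 ?posrE//; last by rewrite ltr_pwDl// sqr_ge0.
rewrite -[2]/(1 + 1) lerD2l exprMn -[X in _ * X]real_normK ?num_real// -exprMn.
rewrite expr_le1 ?mulr_ge0 ?(ltW k0)//.
by rewrite mulrC -ler_pdivlMr// div1r.
Qed.

Lemma barrier'_poly_ge (P : {poly R[i]}) r (k x y : R) :
  P = lead_coef P *: \prod_(z <- r) ('X - z%:P) -> 0 < k ->
  cabs (lead_coef P) = k ^+ (size r).+1 ->
  k ^+ 2 / 2 <= k * barrier' k r x + cabs P.[(x +i* y)%C] ^+ 2.
Proof.
move=> PE k0 kE.
have [/hasP[z zr hz]|/hasPn h] := boolP (has (fun z => `|x - complex.Re z| <= k^-1) r).
  rewrite -[leLHS]addr0 lerD ?sqr_ge0// expr2 -mulrA ler_pM2l//.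
  exact: barrier'_ge hz.
suff kP : k <= cabs P.[(x +i* y)%C].
  have := barrier'_ge0 r x (ltW k0); have : k ^+ 2 <= cabs P.[(x +i* y)%C] ^+ 2.
    by rewrite ler_pXn2r ?nnegrE ?cabs_ge0// ltW.
  have := sqr_ge0 k; have := k0; move: (cabs _ ^+ 2) (barrier' _ _ _) => Q b; nra.
(* No root has real part within [k^-1] of [x]. Each of the [size r] linear factors costs at most one
   power of [k], and one power is left. *)
have -> : k = cabs (lead_coef P) * k^-1 ^+ size r.
  by rewrite kE exprS exprVn mulfK// expf_neq0// gt_eqF.
apply: cabs_horner_ge PE _ _; first by rewrite invr_ge0 ltW.
move=> z /h; rewrite -ltNge => /ltW /le_trans; apply.
rewrite (_ : x - _ = complex.Re ((x +i* y)%C - z)); first exact: Re_le_cabs.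
by case: z.
Qed.


(** In the large coordinate [p] differs from every root by at least 3/5 - 1/2 = 1/10. *)
Lemma cabs_away_ge (P : {poly R[i]}) r (p : R * R) :
  P = lead_coef P *: \prod_(z <- r) ('X - z%:P) ->
  (forall z, z \in r -> cabs z < 2^-1) ->
  3/5 <= `|p.1| \/ 3/5 <= `|p.2| ->
  cabs (lead_coef P) * 10^-1 ^+ size r <= cabs P.[zeta p].
Proof.
case: p => x y /= PE hr hxy; apply: cabs_horner_ge PE _ _; first by rewrite invr_ge0.
have sep (u v c : R) : `|v| <= c -> c < 2^-1 -> 3/5 <= `|u| -> 10^-1 <= `|u - v|.
  by move=> h1 h2 h3; have := ler_normD (u - v) v; rewrite subrK; lra.
case=> z1 z2 /hr hz; case: hxy => h.
  apply: le_trans (sep _ _ _ (Re_le_cabs (z1 +i* z2)%C) hz h) _.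
  by apply: (le_trans _ (Re_le_cabs _)).
apply: le_trans (sep _ _ _ (Im_le_cabs (z1 +i* z2)%C) hz h) _.
by apply: (le_trans _ (Im_le_cabs _)).
Qed.

End Polynomial.

(** * Pointwise inequalities: magnetic energy and cutoff errors *)

Section Pointwise.
Variable R : realType.
Implicit Types a b p q k m : R.

(** Here [a] and [b] are the real and imaginary parts of [u], [(p, q)] is the gradient of [phi], [f]
    is the barrier without its factor [k], while [f'] is the derivative with that factor, and [Q] is
    [|P|^2]. The two squares after [4 * M ^+ 2] add up to [4 |D u|^2]. *)
Lemma magnetic_energy_ge a ax ay b bx by_ p q f f' M k Q :
  `|f| <= M -> k ^+ 2 / 2 <= f' + Q ->
  k ^+ 2 / 4 * (a ^+ 2 + b ^+ 2) <=
  f' * (a ^+ 2 + b ^+ 2) + k * f * (2 * (a * ax + b * bx)) +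
  Q * (a ^+ 2 + b ^+ 2) +
  4 * M ^+ 2 * ((ax - q * b - by_ + p * a) ^+ 2 + (bx + q * a + ay + p * b) ^+ 2 +
    2 * (ax * by_ - ay * bx) -
    p * (2 * (a * ax + b * bx)) - q * (2 * (a * ay + b * by_))).
Proof.
move=> fM kQ.
have f2 : f ^+ 2 <= M ^+ 2.
  by rewrite -(real_normK (num_real f)) ler_pXn2r// nnegrE ?(le_trans _ fM).
set X := (ax - q * b) ^+ 2 + (bx + q * a) ^+ 2.
set Y := (ay + p * b) ^+ 2 + (by_ - p * a) ^+ 2.
(* The magnetic identity: the bracket is [|X u|^2 + |Y u|^2]. *)
rewrite [X in _ <= _ + 4 * M ^+ 2 * X](_ : _ = X + Y); last by rewrite /X /Y; ring.
have X0 : 0 <= X by rewrite addr_ge0 ?sqr_ge0.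
have Y0 : 0 <= Y by rewrite addr_ge0 ?sqr_ge0.
have g0 : 0 <= a ^+ 2 + b ^+ 2 by rewrite addr_ge0 ?sqr_ge0.
(* Cauchy-Schwarz as a completed square, [|k u / 2 + 2 f X u|^2]; the magnetic potential drops out
   of the cross term because [a * ax + b * bx] is also the real part of [conj(u) X u]. *)
have sq : 0 <= k ^+ 2 / 4 * (a ^+ 2 + b ^+ 2) + k * f * (2 * (a * ax + b * bx)) + 4 * f ^+ 2 * X.
  rewrite (_ : _ + _ = (k * a / 2 + 2 * f * (ax - q * b)) ^+ 2 +
    (k * b / 2 + 2 * f * (bx + q * a)) ^+ 2); last by rewrite /X; field.
  by rewrite addr_ge0 ?sqr_ge0.
have h1 : f ^+ 2 * X <= M ^+ 2 * X by rewrite ler_wpM2r.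
have h2 : 0 <= M ^+ 2 * Y by rewrite mulr_ge0 ?sqr_ge0.
have h3 := ler_wpM2r g0 kQ.
have -> : 4 * M ^+ 2 * (X + Y) = 4 * (M ^+ 2 * X) + 4 * (M ^+ 2 * Y) by ring.
have -> : f' * (a ^+ 2 + b ^+ 2) = (f' + Q) * (a ^+ 2 + b ^+ 2) - Q * (a ^+ 2 + b ^+ 2) by ring.
move: h1 h2 h3 sq; move: (M ^+ 2 * X) (M ^+ 2 * Y) => U V.
rewrite -[4 * f ^+ 2 * X]mulrA; move: (f ^+ 2 * X) => W h1 h2 h3 sq.
have -> : k ^+ 2 / 4 * (a ^+ 2 + b ^+ 2) = k ^+ 2 / 2 * (a ^+ 2 + b ^+ 2) - k ^+ 2 / 4 * (a ^+ 2 + b ^+ 2) by field.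
lra.
Qed.

(** The parallelogram law: [2|S|^2 + 2|T|^2 - |S + T|^2 = |S - T|^2], with [S] the term of [dbar w]
    and [T] that of the cutoff gradient. The coefficient 8 compensates the 1/4 in [|dbar w|^2]. *)
Lemma cutoff_dbar_le (e c cx cy u v d1 d2 : R) :
  (e * (c * d1 + cx * u - cy * v)) ^+ 2 + (e * (c * d2 + cx * v + cy * u)) ^+ 2 <=
  8 * c ^+ 2 * (e ^+ 2 * ((d1 ^+ 2 + d2 ^+ 2) / 4)) +
  2 * (cx ^+ 2 + cy ^+ 2) * (e ^+ 2 * (u ^+ 2 + v ^+ 2)).
Proof.
rewrite -subr_ge0.
rewrite (_ : _ - _ = (e * (c * d1 - (cx * u - cy * v))) ^+ 2 +
  (e * (c * d2 - (cx * v + cy * u))) ^+ 2); last by field.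
by rewrite addr_ge0 ?sqr_ge0.
Qed.

End Pointwise.

Section Absorption.
Variable R : realType.

(** Meant for [lam = k^2], [c] the cutoff, [m = |w|^2 e^(-2 phi)], [E] the density of [|dbar w|^2],
    [L] the Laplacian of [phi], [Q = |P|^2] and [T = 4 |D u|^2]. The cutoff gradient leaves an error
    [8 M^2 m]. Where [c >= kap] it takes at most half of [lam * kap^2 / 4 * m]; elsewhere [Q] is so
    large that [m] and [lam * m] are both at most [B / eps * (L * m)]. *)
Lemma cutoff_absorb (lam kap M B eps c m E L Q T D : R) :
  0 <= lam -> 0 < kap -> kap <= 1 -> 0 < eps -> 0 <= m -> 0 <= E -> 0 <= L ->
  0 <= B -> 0 <= c -> c <= 1 -> Q <= B * L -> T <= 8 * c ^+ 2 * E + 2 * m ->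
  64 * M ^+ 2 <= lam * kap ^+ 2 ->
  kap <= c \/ (lam * eps <= Q /\ eps <= Q) ->
  lam / 4 * (c ^+ 2 * m) <= D + Q * (c ^+ 2 * m) + 4 * M ^+ 2 * (T + L * (c ^+ 2 * m)) ->
  lam * kap ^+ 2 / 8 * m <=
  D + (B + 36 * M ^+ 2 + (8 * M ^+ 2 + 1) * B / eps) * (L * m + E).
Proof.
move=> lam0 kap0 kap1 eps0 m0 E0 L0 B0 c0 c1 QBL hT hM hcase H.
have c2 : c ^+ 2 <= 1 by rewrite expr_le1.
have M0 := sqr_ge0 M.
have V0 : 0 <= L * m by rewrite mulr_ge0.
have cE : c ^+ 2 * E <= E by rewrite ler_piMl.
have cV : c ^+ 2 * (L * m) <= L * m by rewrite ler_piMl.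
have cV0 : 0 <= c ^+ 2 * (L * m) by rewrite mulr_ge0// sqr_ge0.
have hQ : Q * (c ^+ 2 * m) <= B * (L * m).
  apply: (@le_trans _ _ (B * L * (c ^+ 2 * m))).
    by rewrite ler_wpM2r// mulr_ge0// sqr_ge0.
  by rewrite (_ : _ * _ = B * (c ^+ 2 * (L * m))); [rewrite ler_wpM2l|ring].
have hT' : M ^+ 2 * (T + L * (c ^+ 2 * m)) <= M ^+ 2 * (8 * E + 2 * m + L * m).
  rewrite ler_wpM2l// (_ : L * (c ^+ 2 * m) = c ^+ 2 * (L * m)); last by ring.
  by rewrite lerD//; lra.
(* Everything except [D] and the error [8 M^2 m] is charged to [L * m + E]; 36 is 32 from [E] plus 4
   from [L * m]. *)
have base : lam / 4 * (c ^+ 2 * m) <=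
    D + (B + 36 * M ^+ 2) * (L * m + E) + 8 * (M ^+ 2 * m).
  have p1 : 0 <= B * E by rewrite mulr_ge0.
  have p2 : 0 <= M ^+ 2 * E by rewrite mulr_ge0.
  have p3 : 0 <= M ^+ 2 * (L * m) by rewrite mulr_ge0.
  have -> : (B + 36 * M ^+ 2) * (L * m + E) =
    B * (L * m) + B * E + 36 * (M ^+ 2 * (L * m)) + 36 * (M ^+ 2 * E) by ring.
  move: H hT'.
  have -> : M ^+ 2 * (8 * E + 2 * m + L * m) =
    8 * (M ^+ 2 * E) + 2 * (M ^+ 2 * m) + M ^+ 2 * (L * m) by ring.
  rewrite -[4 * M ^+ 2 * _]mulrA.
  move: (M ^+ 2 * E) (M ^+ 2 * m) (M ^+ 2 * (L * m)) (M ^+ 2 * (T + _)) p2 p3 => *.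
  lra.
have Be0 : 0 <= B / eps by rewrite divr_ge0// ltW.
have rest0 : 0 <= (8 * M ^+ 2 + 1) * (B / eps) by rewrite mulr_ge0//; lra.
have VE0 : 0 <= L * m + E by lra.
rewrite -[(8 * M ^+ 2 + 1) * B / eps]mulrA [(_ + _ + _) * _]mulrDl.
case: hcase => [kc|[hl he]].
  have h1 : lam * kap ^+ 2 * m <= lam * (c ^+ 2 * m).
    by rewrite -mulrA ler_wpM2l// ler_wpM2r// ler_pXn2r// nnegrE ltW.
  have h2 : 64 * M ^+ 2 * m <= lam * kap ^+ 2 * m by rewrite ler_wpM2r.
  have h3 : 0 <= (8 * M ^+ 2 + 1) * (B / eps) * (L * m + E) by rewrite mulr_ge0.
  move: base h1 h2 h3; rewrite -[64 * _ * _]mulrA.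
  have -> : lam / 4 * (c ^+ 2 * m) = lam * (c ^+ 2 * m) / 4 by field.
  have -> : lam * kap ^+ 2 / 8 * m = lam * kap ^+ 2 * m / 8 by field.
  move: (lam * (_ * m)) (lam * kap ^+ 2 * m) (M ^+ 2 * m) ((B + _) * (_ + _)) (_ * (B / eps) * _) => *.
  lra.
(* Far from the roots: [Q <= B * L] converts the lower bounds on [Q] into bounds by [L * m]. *)
have QV : Q * m / eps <= B / eps * (L * m).
  have -> : B / eps * (L * m) = B * L * m / eps by field; rewrite gt_eqF.
  by rewrite ler_wpM2r ?invr_ge0 ?(ltW eps0)// ler_wpM2r.
have h1 : lam * m <= B / eps * (L * m).
  apply: le_trans QV; rewrite ler_pdivlMr// (_ : _ * eps = lam * eps * m); last by ring.
  by rewrite ler_wpM2r.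
have h2 : m <= B / eps * (L * m).
  apply: le_trans QV; rewrite ler_pdivlMr// mulrC.
  by rewrite ler_wpM2r.
have h3 : M ^+ 2 * m <= M ^+ 2 * (B / eps * (L * m)) by rewrite ler_wpM2l.
have h4 : 0 <= lam / 4 * (c ^+ 2 * m) by rewrite !mulr_ge0// ?sqr_ge0// invr_ge0.
have h5 : lam * kap ^+ 2 / 8 * m <= lam * m.
  have -> : lam * kap ^+ 2 / 8 * m = (lam * m) * (kap ^+ 2 / 8) by field.
  rewrite ler_piMr ?mulr_ge0//.
  have : kap ^+ 2 <= 1 by rewrite expr_le1// ltW.
  lra.
have h6 : 0 <= (8 * M ^+ 2 + 1) * (B / eps) * E by rewrite mulr_ge0.
move: h3 h6 base h1 h4 h5.
have -> : (8 * M ^+ 2 + 1) * (B / eps) * (L * m + E) =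
  8 * (M ^+ 2 * (B / eps * (L * m))) + B / eps * (L * m) +
  (8 * M ^+ 2 + 1) * (B / eps) * E by ring.
move: (M ^+ 2 * (B / eps * (L * m))) (B / eps * (L * m)) (_ * (B / eps) * E).
move: ((B + 36 * M ^+ 2) * (L * m + E)) (M ^+ 2 * m) (lam / 4 * _).
move: (lam * kap ^+ 2 / 8 * m) (lam * m) => *.
lra.
Qed.

End Absorption.

(** * Partial derivatives on the disc *)

Section DiscDerivatives.
Variable R : realType.

Lemma sqr_cabs_zeta (p : R * R) : cabs (zeta p) ^+ 2 = p.1 ^+ 2 + p.2 ^+ 2.
Proof. by rewrite sqr_cabs. Qed.

Lemma discE (p : R * R) : disc R p <-> p.1 ^+ 2 + p.2 ^+ 2 < 1.
Proof.
rewrite -sqr_cabs_zeta -[in X in _ <-> X](expr1n _ 2).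
by rewrite ltr_pXn2r// nnegrE ?cabs_ge0.
Qed.

Lemma disc_open : open (disc R).
Proof.
rewrite (_ : disc R = (fun p : R * R => p.1 ^+ 2 + p.2 ^+ 2) @^-1` [set x | x < 1]).
  apply: open_comp; last exact: open_lt.
  move=> p _; apply: cvgD; apply: cvgM; by [exact: cvg_fst|exact: cvg_snd].
by apply/seteqP; split => p /discE.
Qed.

(** The increment [h *: ex R] leaves the second coordinate fixed, so both difference quotients
    coincide. *)
Lemma dx_slice (f : R * R -> R) p : derivable (f : R^o * R^o -> R^o) p (ex R) ->
  is_derive p.1 (1 : R) (fun t : R => f (t, p.2)) (dx f p).
Proof.
case: p => x y df.
have E : (fun h : R => h^-1 *: (((f : R^o * R^o -> R^o) \o shift (x, y)) (h *: ex R) - f (x, y))) =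
    (fun h : R => h^-1 *: (((fun t : R => f (t, y)) \o shift x) (h *: 1) - f (x, y))).
  apply/funext => h /=; congr (_ *: (f _ - _)).
  by congr (_, _); rewrite [X in X + _]mulr0 add0r.
apply: DeriveDef; first by move: df; rewrite /derivable E.
by rewrite /dx /derive E.
Qed.

Lemma dy_slice (f : R * R -> R) p : derivable (f : R^o * R^o -> R^o) p (ey R) ->
  is_derive p.2 (1 : R) (fun t : R => f (p.1, t)) (dy f p).
Proof.
case: p => x y df.
have E : (fun h : R => h^-1 *: (((f : R^o * R^o -> R^o) \o shift (x, y)) (h *: ey R) - f (x, y))) =
    (fun h : R => h^-1 *: (((fun t : R => f (x, t)) \o shift y) (h *: 1) - f (x, y))).
  apply/funext => h /=; congr (_ *: (f _ - _)).
  by congr (_, _); rewrite [X in X + _]mulr0 add0r.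
apply: DeriveDef; first by move: df; rewrite /derivable E.
by rewrite /dy /derive E.
Qed.

Lemma near_disc_eq (f g : R * R -> R) p : {in disc R, f =1 g} -> disc R p ->
  \forall q \near p, g q = f q.
Proof.
move=> fg dp; apply: filterS (open_nbhs_nbhs (conj disc_open dp)) => q dq.
by rewrite fg// inE.
Qed.

Lemma continuous_disc_eq (f g : R * R -> R) p : {in disc R, f =1 g} -> disc R p ->
  {for p, continuous g} -> {for p, continuous f}.
Proof.
move=> fg dp cg; rewrite /prop_for /continuous_at fg ?inE//.
by apply: cvg_trans cg; apply: near_eq_cvg; exact: near_disc_eq.
Qed.

Lemma continuous_cdisc (f : R * R -> R) p :
  {within cdisc R, continuous f} -> disc R p -> {for p, continuous f}.
Proof.
move=> cf dp; have : {within disc R, continuous f}.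
  by apply: continuous_subspaceW cf => q /ltW.
rewrite continuous_open_subspace; last exact: disc_open.
by apply; rewrite inE.
Qed.

Lemma Cclosed1_C1_on (f : R * R -> R) : Cclosed 1 f -> C1_on (disc R) f (dx f) (dy f).
Proof.
move=> [cf [df [[gx [[cgx _] fx]] [gy [[cgy _] fy]]]]] p dp.
have [dfx dfy] := df p dp; split.
- exact: continuous_cdisc.
- exact: continuous_disc_eq fx dp (continuous_cdisc cgx dp).
- exact: continuous_disc_eq fy dp (continuous_cdisc cgy dp).
- exact: dx_slice.
- exact: dy_slice.
Qed.

Lemma dx_eq (f g : R * R -> R) : {in disc R, f =1 g} -> {in disc R, dx f =1 dx g}.
Proof.
move=> fg p /set_mem dp; apply/esym.
exact: (@near_eq_derive _ (R^o * R^o)%type R^o g f p (ex R) (near_disc_eq fg dp)).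
Qed.

Lemma dy_eq (f g : R * R -> R) : {in disc R, f =1 g} -> {in disc R, dy f =1 dy g}.
Proof.
move=> fg p /set_mem dp; apply/esym.
exact: (@near_eq_derive _ (R^o * R^o)%type R^o g f p (ey R) (near_disc_eq fg dp)).
Qed.

Lemma near_disc_slices p : disc R p ->
  (\forall t \near p.1, disc R (t, p.2)) /\ (\forall t \near p.2, disc R (p.1, t)).
Proof.
case: p => x y dp; have nd := open_nbhs_nbhs (conj disc_open dp).
have c1 : (t, y) @[t --> x] --> nbhs (x, y).
  by apply: (@cvg_pair _ _ _ _ (nbhs x) (nbhs y)); [exact: cvg_id|exact: cvg_cst].
have c2 : (x, t) @[t --> y] --> nbhs (x, y).
  by apply: (@cvg_pair _ _ _ _ (nbhs x) (nbhs y)); [exact: cvg_cst|exact: cvg_id].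
by split; [exact: c1 nd|exact: c2 nd].
Qed.

(** [Cclosed] gives regular functions that agree with the partial derivatives on the open disc only.
    Openness makes the agreement hold near each point, so continuity and derivatives transfer. *)
Lemma C1_on_disc_eq (f g : R * R -> R) : {in disc R, f =1 g} ->
  C1_on (disc R) g (dx g) (dy g) -> C1_on (disc R) f (dx f) (dy f).
Proof.
move=> fg gC1 p dp; have [cg cgx cgy dgx dgy] := gC1 p dp.
have pd : p \in disc R by rewrite inE.
have [n1 n2] := near_disc_slices dp.
split.
- exact: continuous_disc_eq cg.
- exact: continuous_disc_eq (dx_eq fg) dp cgx.
- exact: continuous_disc_eq (dy_eq fg) dp cgy.
- rewrite (dx_eq fg pd); apply: near_eq_is_derive dgx.
  by apply: filterS n1 => t dt; rewrite fg// inE.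
- rewrite (dy_eq fg pd); apply: near_eq_is_derive dgy.
  by apply: filterS n2 => t dt; rewrite fg// inE.
Qed.

Lemma Cclosed2_C1_on (f : R * R -> R) : Cclosed 2 f ->
  [/\ C1_on (disc R) f (dx f) (dy f),
      C1_on (disc R) (dx f) (dx (dx f)) (dy (dx f)) &
      C1_on (disc R) (dy f) (dx (dy f)) (dy (dy f))].
Proof.
move=> [cf [df [[gx [gx1 fx]] [gy [gy1 fy]]]]]; split.
- apply: Cclosed1_C1_on; split => //; split => //; split.
    by exists gx; split => //; split => //; case: gx1.
  by exists gy; split => //; split => //; case: gy1.
- exact: C1_on_disc_eq fx (Cclosed1_C1_on gx1).
- exact: C1_on_disc_eq fy (Cclosed1_C1_on gy1).
Qed.

End DiscDerivatives.

(** * C^1 calculus for products, the weight and the cutoff *)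

Section C1Algebra.
Variable R : realType.
Implicit Types (D : set (R * R)) (f g : R * R -> R).

Lemma C1_onM D f fx fy g gx gy : C1_on D f fx fy -> C1_on D g gx gy ->
  C1_on D (fun p => f p * g p) (fun p => fx p * g p + f p * gx p)
    (fun p => fy p * g p + f p * gy p).
Proof.
move=> fC1 gC1 p Dp.
have [cf cfx cfy dfx dfy] := fC1 p Dp; have [cg cgx cgy dgx dgy] := gC1 p Dp.
split; try by [apply: continuousM|apply: continuousD; apply: continuousM].
- by apply: is_derive_eq; rewrite /GRing.scale/= -surjective_pairing; ring.
- by apply: is_derive_eq; rewrite /GRing.scale/= -surjective_pairing; ring.
Qed.

Lemma C1_on_expRN D f fx fy : C1_on D f fx fy ->
  C1_on D (fun p => expR (- f p)) (fun p => - fx p * expR (- f p))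
    (fun p => - fy p * expR (- f p)).
Proof.
move=> fC1 p Dp; have [cf cfx cfy dfx dfy] := fC1 p Dp.
have ce : {for p, continuous (fun p => expR (- f p))}.
  by apply: (@continuous_comp _ _ _ (fun p => - f p) expR); [exact: continuousN|exact: continuous_expR].
split.
- exact: ce.
- by apply: continuousM; [exact: continuousN|exact: ce].
- by apply: continuousM; [exact: continuousN|exact: ce].
- have := @is_derive1_comp _ (@expR R) (fun t => - f (t, p.2)) p.1 _ _ (is_derive_expR _) (is_deriveN dfx).
  by rewrite -surjective_pairing mulrC.
- have := @is_derive1_comp _ (@expR R) (fun t => - f (p.1, t)) p.2 _ _ (is_derive_expR _) (is_deriveN dfy).
  by rewrite -surjective_pairing mulrC.
Qed.

(** A polynomial vanishing on the sides of the square: integrals over the square then have no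
    boundary terms. *)
Definition cutoff (s : R) (p : R * R) : R := (s ^+ 2 - p.1 ^+ 2) * (s ^+ 2 - p.2 ^+ 2).
Definition cutoffx (s : R) (p : R * R) : R := - (2 * p.1) * (s ^+ 2 - p.2 ^+ 2).
Definition cutoffy (s : R) (p : R * R) : R := - (2 * p.2) * (s ^+ 2 - p.1 ^+ 2).

Lemma C1_on_cutoff D s : C1_on D (cutoff s) (cutoffx s) (cutoffy s).
Proof.
move=> p _.
have c1 : {for p, continuous (fun q : R * R => q.1)} by exact: cvg_fst.
have c2 : {for p, continuous (fun q : R * R => q.2)} by exact: cvg_snd.
have cc (c : R) : {for p, continuous (fun q : R * R => c)} by exact: cvg_cst.
split.
- by apply: continuousM; apply: continuousB => //; apply: continuousM.
- apply: continuousM; first by apply: continuousN; exact: continuousM.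
  by apply: continuousB => //; apply: continuousM.
- apply: continuousM; first by apply: continuousN; exact: continuousM.
  by apply: continuousB => //; apply: continuousM.
- by rewrite /cutoff/=; apply: is_derive_eq; rewrite /cutoffx /GRing.scale/=; ring.
- by rewrite /cutoff/=; apply: is_derive_eq; rewrite /cutoffy /GRing.scale/=; ring.
Qed.

Lemma C1_onS D D' f fx fy : D' `<=` D -> C1_on D f fx fy -> C1_on D' f fx fy.
Proof. by move=> sD fC1 p /sD /fC1. Qed.

End C1Algebra.

(** * Exact terms as functions of integral zero *)

Section NullMean.
Variables (R : realType) (s : R).

Definition null_mean (h : R * R -> R) :=
  (forall p, square s p -> {for p, continuous h}) /\
  (\int[area R]_(p in square s) (h p)%:E = 0)%E.

Lemma null_meanD (c : R) f g : null_mean f -> null_mean g ->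
  null_mean (fun p => f p + c * g p).
Proof.
move=> [cf f0] [cg g0].
have cg' p : square s p -> {for p, continuous (fun p => c * g p)}.
  by move=> sp; apply: continuousM; [exact: cvg_cst|exact: cg].
split; first by move=> p sp; apply: continuousD; [exact: cf|exact: cg'].
under eq_integral do rewrite EFinD.
rewrite integralD//=; first last.
- exact: integrable_square cg'.
- exact: integrable_square cf.
- exact: measurable_square.
rewrite f0 add0e; under eq_integral do rewrite EFinM.
rewrite integralZl//=; first by rewrite g0 mule0.
- exact: measurable_square.
- exact: integrable_square cg.
Qed.

End NullMean.

Section Fluxes.
Variables (R : realType) (D : set (R * R)) (s t : R) (a ax ay b bx by_ : R * R -> R).
Hypotheses (s0 : 0 < s) (st : s < t).
Hypotheses (sub_sd : square s `<=` D) (sub_td : square t `<=` D).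
Hypotheses (aC1 : C1_on D a ax ay) (bC1 : C1_on D b bx by_).
Hypothesis a0 : forall z, [/\ a (z, s) = 0, a (z, - s) = 0, a (s, z) = 0 & a (- s, z) = 0].
Hypothesis b0 : forall z, [/\ b (z, s) = 0, b (z, - s) = 0, b (s, z) = 0 & b (- s, z) = 0].

Lemma jacobian_null : null_mean s (fun q => ax q * by_ q - ay q * bx q).
Proof.
split.
  move=> q /sub_sd dq; have [_ ? ? _ _] := aC1 dq; have [_ ? ? _ _] := bC1 dq.
  by apply: continuousB; apply: continuousM.
apply: (@integral_jacobian _ s t a ax ay b bx by_).
- exact: s0.
- exact: st.
- exact: C1_onS sub_td aC1.
- exact: C1_onS sub_td bC1.
- by move=> x; case: (a0 x).
- by move=> x; case: (a0 x).
- by move=> x; case: (a0 x).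
- by move=> x; case: (a0 x).
Qed.

Let g q := a q ^+ 2 + b q ^+ 2.

(** The integrand is the [x]-derivative of [f * g], and [g = |u|^2] vanishes on the sides. *)
Lemma flux_x_null (f f' : R * R -> R) :
  (forall q, D q -> [/\ {for q, continuous f}, {for q, continuous f'} &
     is_derive q.1 (1 : R) (fun x => f (x, q.2)) (f' q)]) ->
  null_mean s (fun q => f' q * g q + f q * (2 * (a q * ax q + b q * bx q))).
Proof.
move=> fC1; have ch q : square s q -> {for q, continuous
    (fun q => f' q * g q + f q * (2 * (a q * ax q + b q * bx q)))}.
  move=> /sub_sd dq; have [? ? _] := fC1 _ dq.
  have [? ? _ _ _] := aC1 dq; have [? ? _ _ _] := bC1 dq.
  apply: continuousD; apply: continuousM => //.
    by apply: continuousD; apply: continuousM.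
  by apply: continuousM; [exact: cvg_cst|apply: continuousD; apply: continuousM].
split => //.
apply: (@integral_square_dx0 _ s (fun q => f q * g q)) => //.
- move=> q /sub_sd dq; have [_ _ df] := fC1 _ dq.
  have [_ _ _ da _] := aC1 dq; have [_ _ _ db _] := bC1 dq.
  by rewrite /g/=; apply: is_derive_eq; rewrite /GRing.scale/= -surjective_pairing; ring.
- by move=> y; rewrite /g; case: (a0 y) => _ _ -> _; case: (b0 y) => _ _ -> _; ring.
- by move=> y; rewrite /g; case: (a0 y) => _ _ _ ->; case: (b0 y) => _ _ _ ->; ring.
Qed.

Lemma flux_y_null (f f' : R * R -> R) :
  (forall q, D q -> [/\ {for q, continuous f}, {for q, continuous f'} &
     is_derive q.2 (1 : R) (fun y => f (q.1, y)) (f' q)]) ->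
  null_mean s (fun q => f' q * g q + f q * (2 * (a q * ay q + b q * by_ q))).
Proof.
move=> fC1; have ch q : square s q -> {for q, continuous
    (fun q => f' q * g q + f q * (2 * (a q * ay q + b q * by_ q)))}.
  move=> /sub_sd dq; have [? ? _] := fC1 _ dq.
  have [? _ ? _ _] := aC1 dq; have [? _ ? _ _] := bC1 dq.
  apply: continuousD; apply: continuousM => //.
    by apply: continuousD; apply: continuousM.
  by apply: continuousM; [exact: cvg_cst|apply: continuousD; apply: continuousM].
split => //.
apply: (@integral_square_dy0 _ s (fun q => f q * g q)) => //.
- move=> q /sub_sd dq; have [_ _ df] := fC1 _ dq.
  have [_ _ _ _ da] := aC1 dq; have [_ _ _ _ db] := bC1 dq.
  by rewrite /g/=; apply: is_derive_eq; rewrite /GRing.scale/= -surjective_pairing; ring.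
- by move=> x; rewrite /g; case: (a0 x) => -> _ _ _; case: (b0 x) => -> _ _ _; ring.
- by move=> x; rewrite /g; case: (a0 x) => _ -> _ _; case: (b0 x) => _ -> _ _; ring.
Qed.

End Fluxes.

(** * The estimate on a square *)

Lemma square_sub_disc (R : realType) (l : R) : 2 * l ^+ 2 < 1 -> square l `<=` disc R.
Proof.
move=> l1 [x y] [/=]; rewrite !in_itv/= => hx hy; apply/discE => /=.
have sq (z : R) : - l <= z <= l -> z ^+ 2 <= l ^+ 2.
  by move=> /andP[z1 z2]; nra.
by have := sq _ hx; have := sq _ hy; lra.
Qed.

Lemma sqr_cabs_dbar (R : realType) (w : R * R -> R[i]) (q : R * R) :
  cabs (dbar w q) ^+ 2 =
  ((dx (repart w) q - dy (impart w) q) ^+ 2 +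
   (dx (impart w) q + dy (repart w) q) ^+ 2) / 4.
Proof.
have -> : dbar w q = (((dx (repart w) q - dy (impart w) q) / 2) +i*
    ((dx (impart w) q + dy (repart w) q) / 2))%C.
  rewrite /dbar /dxc /dyc.
  have -> : (2^-1 : R[i]) = (2^-1 +i* 0)%C by rewrite complexr0 rmorphV ?unitfE// rmorph_nat.
  by simpc; congr (_ +i* _)%C; ring.
by rewrite sqr_cabs/=; field.
Qed.

Section LocalEstimate.
Variables (R : realType) (phi : R * R -> R) (w : R * R -> R[i]).
Hypotheses (phiC2 : Cclosed 2 phi) (wC1 : Cclosed_complex 1 w).

(** Both squares lie in the disc, as [2 s^2 = 0.98] and [2 t^2 < 1]. Since [s > 3/5], points outside
    the smaller one are away from all roots. *)
Let s : R := 7 / 10.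
Let t : R := 141 / 200.

Let sub_sd : square s `<=` disc R.
Proof. by apply: square_sub_disc; rewrite /s; lra. Qed.

Let sub_td : square t `<=` disc R.
Proof. by apply: square_sub_disc; rewrite /t; lra. Qed.

(** These [u] and [v] are the parts of [w]. The function [u = chi w e^(-phi)] of the idea above has
    the parts [a] and [b] below. *)
Let u := repart w.
Let v := impart w.
Let p1 := dx phi.
Let p2 := dy phi.
Let e q := expR (- phi q).
Let ce q := cutoff s q * e q.
Let cex q := cutoffx s q * e q + cutoff s q * (- p1 q * e q).
Let cey q := cutoffy s q * e q + cutoff s q * (- p2 q * e q).
Let a q := ce q * u q.
Let ax q := cex q * u q + ce q * dx u q.
Let ay q := cey q * u q + ce q * dy u q.
Let b q := ce q * v q.
Let bx q := cex q * v q + ce q * dx v q.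
Let by_ q := cey q * v q + ce q * dy v q.

Let phi1 := let: And3 h _ _ := Cclosed2_C1_on phiC2 in h.
Let phi2 := let: And3 _ h _ := Cclosed2_C1_on phiC2 in h.
Let phi3 := let: And3 _ _ h := Cclosed2_C1_on phiC2 in h.

Let ceC1 : C1_on (disc R) ce cex cey.
Proof. by apply: C1_onM; [exact: C1_on_cutoff|exact: C1_on_expRN]. Qed.

Let aC1 : C1_on (disc R) a ax ay.
Proof. by apply: C1_onM => //; apply: Cclosed1_C1_on; case: wC1. Qed.

Let bC1 : C1_on (disc R) b bx by_.
Proof. by apply: C1_onM => //; apply: Cclosed1_C1_on; case: wC1. Qed.

Let ce0 z : [/\ ce (z, s) = 0, ce (z, - s) = 0, ce (s, z) = 0 & ce (- s, z) = 0].
Proof. by split; rewrite /ce /cutoff/= ?sqrrN subrr ?mulr0 !mul0r. Qed.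

Let s0 : 0 < s. Proof. by rewrite /s; lra. Qed.


Let gE q : a q ^+ 2 + b q ^+ 2 =
  cutoff s q ^+ 2 * (cabs (w q) ^+ 2 * expR (- 2 * phi q)).
Proof.
have -> : expR (- 2 * phi q) = e q * e q by rewrite /e -expRD; congr expR; ring.
by rewrite sqr_cabs -/(repart w q) -/(impart w q) /a /b /ce /u /v; ring.
Qed.

(** The derivatives of [phi] cancel: [D u = e^(-phi) dbar (chi w)]. The rest is [cutoff_dbar_le] and
    the bound 1 for the squared gradient of the cutoff. *)
Let dbar_energy q : square s q ->
  (ax q - p2 q * b q - by_ q + p1 q * a q) ^+ 2 +
  (bx q + p2 q * a q + ay q + p1 q * b q) ^+ 2 <=
  8 * cutoff s q ^+ 2 * (cabs (dbar w q) ^+ 2 * expR (- 2 * phi q)) +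
  2 * (cabs (w q) ^+ 2 * expR (- 2 * phi q)).
Proof.
move=> sq.
have eE : expR (- 2 * phi q) = e q ^+ 2 by rewrite expr2 /e -expRD; congr expR; ring.
(* Each of the two squares is at most [4 * (49/100)^3 < 1/2]. *)
have grad : cutoffx s q ^+ 2 + cutoffy s q ^+ 2 <= 1.
  case: q sq {eE} => x y [/=]; rewrite !in_itv/= /cutoffx /cutoffy/= /s => hx hy.
  have b2 (z : R) : - (7 / 10) <= z <= 7 / 10 -> 0 <= z ^+ 2 /\ z ^+ 2 <= 49 / 100.
    by move=> /andP[z1 z2]; split; [exact: sqr_ge0|nra].
  have [x0 x1] := b2 _ hx; have [y0 y1] := b2 _ hy.
  rewrite (_ : _ + _ = 4 * (x ^+ 2 * ((7 / 10) ^+ 2 - y ^+ 2) ^+ 2) +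
    4 * (y ^+ 2 * ((7 / 10) ^+ 2 - x ^+ 2) ^+ 2)); last by ring.
  move: (x ^+ 2) (y ^+ 2) x0 x1 y0 y1 => X Y x0 x1 y0 y1.
  have h1 : ((7 / 10) ^+ 2 - Y) ^+ 2 <= (49 / 100) ^+ 2 by nra.
  have h2 : ((7 / 10) ^+ 2 - X) ^+ 2 <= (49 / 100) ^+ 2 by nra.
  have h3 : X * ((7 / 10) ^+ 2 - Y) ^+ 2 <= 49 / 100 * (49 / 100) ^+ 2.
    by rewrite ler_pM ?sqr_ge0.
  have h4 : Y * ((7 / 10) ^+ 2 - X) ^+ 2 <= 49 / 100 * (49 / 100) ^+ 2.
    by rewrite ler_pM ?sqr_ge0.
  move: (X * _) (Y * _) h3 h4 => U V h3 h4; lra.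
have := @cutoff_dbar_le R (e q) (cutoff s q) (cutoffx s q) (cutoffy s q) (u q) (v q)
  (dx u q - dy v q) (dx v q + dy u q).
rewrite -sqr_cabs_dbar -eE (_ : u q ^+ 2 + v q ^+ 2 = cabs (w q) ^+ 2); last by rewrite sqr_cabs.
rewrite [_ * cabs (dbar w q) ^+ 2]mulrC [_ * cabs (w q) ^+ 2]mulrC => H.
apply: le_trans (le_trans H _); last first.
  by rewrite lerD2l -[2 * _ * _]mulrA ler_pM2l// ler_piMl// mulr_ge0 ?sqr_ge0//.
rewrite le_eqVlt; apply/orP; left; apply/eqP.
rewrite /ax /ay /bx /by_ /a /b /cex /cey /ce; ring.
Qed.

(** The whole argument on the square in pointwise form: integrations by parts are hidden in the
    single function [D] of integral zero. *)
Lemma local_estimate (P : {poly R[i]}) (r : seq R[i]) (k B : R) :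
  let M := (size r)%:R * pi in
  P = lead_coef P *: \prod_(z <- r) ('X - z%:P) ->
  (forall z, z \in r -> cabs z < 2^-1) ->
  1 <= k -> cabs (lead_coef P) = k ^+ (size r).+1 -> 0 < B ->
  (forall q, disc R q -> B^-1 * cabs P.[zeta q] ^+ 2 <= laplacian phi q) ->
  64 * M ^+ 2 <= k ^+ 2 * 100^-1 ^+ 2 ->
  exists D, null_mean s D /\ forall q, square s q ->
    k ^+ 2 * 100^-1 ^+ 2 / 8 * (cabs (w q) ^+ 2 * expR (- 2 * phi q)) <=
    D q + (B + 36 * M ^+ 2 + (8 * M ^+ 2 + 1) * B / (10^-1 ^+ size r) ^+ 2) *
      (laplacian phi q * (cabs (w q) ^+ 2 * expR (- 2 * phi q)) +
       cabs (dbar w q) ^+ 2 * expR (- 2 * phi q)).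
Proof.
move=> M PE hr k1 kE B0 hL hM; have k0 : 0 < k by lra.
pose f (q : R * R) := k * barrier k r q.1; pose f' (q : R * R) := k * barrier' k r q.1.
have a0 z : [/\ a (z, s) = 0, a (z, - s) = 0, a (s, z) = 0 & a (- s, z) = 0].
  by have [h1 h2 h3 h4] := ce0 z; rewrite /a h1 h2 h3 h4 !mul0r.
have b0 z : [/\ b (z, s) = 0, b (z, - s) = 0, b (s, z) = 0 & b (- s, z) = 0].
  by have [h1 h2 h3 h4] := ce0 z; rewrite /b h1 h2 h3 h4 !mul0r.
have st : s < t by rewrite /s /t; lra.
have n1 := jacobian_null s0 st sub_sd sub_td aC1 bC1 a0.
have n2 := @flux_x_null _ _ _ _ _ _ _ _ _ s0 sub_sd aC1 bC1 a0 b0 f f'.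
have n3 := @flux_x_null _ _ _ _ _ _ _ _ _ s0 sub_sd aC1 bC1 a0 b0 p1 (dx p1).
have n4 := @flux_y_null _ _ _ _ _ _ _ _ _ s0 sub_sd aC1 bC1 a0 b0 p2 (dy p2).
(* [D] is the [x]-derivative of [k * barrier * g], plus [8 M^2] times the Jacobian, minus [4 M^2]
   times the divergence of [g grad phi], with [g = a^2 + b^2]. *)
eexists; split.
  apply: (null_meanD (- (4 * M ^+ 2)) _ (n4 _)).
    apply: (null_meanD (- (4 * M ^+ 2)) _ (n3 _)).
      apply: (null_meanD (8 * M ^+ 2) _ n1).
      apply: n2 => q _.
      have cb : {for q.1, continuous (barrier k r)}.
        exact: is_derive_continuous (is_derive_barrier k r q.1).
      split.
      - apply: continuousM; first exact: cvg_cst.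
        by apply: (@continuous_comp _ _ _ fst (barrier k r)); [exact: cvg_fst|exact: cb].
      - apply: continuousM; first exact: cvg_cst.
        apply: (@continuous_comp _ _ _ fst (barrier' k r)); first exact: cvg_fst.
        exact: barrier'_continuous.
      - have db := is_derive_barrier k r q.1.
        by apply: is_derive_eq; rewrite /f' /GRing.scale/=; ring.
    by move=> q /phi2[h1 h2 _ h4 _]; split; [exact: h1|exact: h2|exact: h4].
  by move=> q /phi3[h1 _ h3 _ h5]; split; [exact: h1|exact: h3|exact: h5].
move=> q sq /=; have dq := sub_sd sq.
pose Q := cabs P.[zeta q] ^+ 2.
have L0 : 0 <= laplacian phi q.
  by apply: le_trans (hL q dq); rewrite mulr_ge0 ?invr_ge0 ?sqr_ge0// ltW.
have e10 : 0 < 10^-1 ^+ size r :> R by rewrite exprn_gt0.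
have [x2 y2] : q.1 ^+ 2 <= 49 / 100 /\ q.2 ^+ 2 <= 49 / 100.
  case: q sq {dq Q L0} => x y [/=]; rewrite !in_itv/= /s => /andP[? ?] /andP[? ?].
  by split; nra.
apply: (@cutoff_absorb R (k ^+ 2) 100^-1 M B ((10^-1 ^+ size r) ^+ 2) (cutoff s q) _ _
  (laplacian phi q) Q ((ax q - p2 q * b q - by_ q + p1 q * a q) ^+ 2 +
  (bx q + p2 q * a q + ay q + p1 q * b q) ^+ 2)).
- exact: sqr_ge0.
- by rewrite invr_gt0.
- by rewrite invf_le1// ler1n.
- by rewrite exprn_gt0.
- by rewrite mulr_ge0 ?sqr_ge0 ?expR_ge0.
- by rewrite mulr_ge0 ?sqr_ge0 ?expR_ge0.
- exact: L0.
- exact: ltW.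
- by rewrite /cutoff /s mulr_ge0//; lra.
- have := sqr_ge0 q.1; have := sqr_ge0 q.2; rewrite /cutoff /s.
  move: (q.1 ^+ 2) (q.2 ^+ 2) x2 y2 => X Y *; nra.
- by rewrite -ler_pdivrMl//; exact: hL.
- exact: dbar_energy.
- exact: hM.
(* In the inner square of half-side 3/5 the cutoff is at least [(49/100 - 9/25)^2 = 0.0169]; outside
   it every root is at distance at least 1/10. *)
- have [h|h] := boolP ((`|q.1| < 3 / 5) && (`|q.2| < 3 / 5)); [left|right].
    have b2 (z : R) : `|z| < 3 / 5 -> z ^+ 2 <= 9 / 25.
      by rewrite ltr_norml => /andP[? ?]; nra.
    move/andP: h => [/b2 h1 /b2 h2]; rewrite /cutoff /s.
    move: (q.1 ^+ 2) (q.2 ^+ 2) x2 y2 h1 h2 => X Y *; nra.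
  have {}h : 3 / 5 <= `|q.1| \/ 3 / 5 <= `|q.2|.
    by move: h; rewrite negb_and -!leNgt => /orP.
  have hP := cabs_away_ge PE hr h; rewrite kE in hP.
  have kk : k <= k ^+ (size r).+1 by rewrite exprS ler_peMr ?exprn_ege1// ltW.
  have lQ : k * 10^-1 ^+ size r <= cabs P.[zeta q].
    by apply: le_trans hP; rewrite ler_wpM2r// ltW.
  have kQ : k ^+ 2 * (10^-1 ^+ size r) ^+ 2 <= Q.
    by rewrite -exprMn ler_pXn2r// nnegrE ?cabs_ge0// mulr_ge0// ltW.
  split => //; apply: le_trans kQ; rewrite ler_peMl ?sqr_ge0//.
  exact: exprn_ege1.
have H := @magnetic_energy_ge R (a q) (ax q) (ay q) (b q) (bx q) (by_ q) (p1 q) (p2 q)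
  (barrier k r q.1) (f' q) M k Q (barrier_le k r q.1) (barrier'_poly_ge q.1 q.2 PE k0 kE).
rewrite -gE; apply: le_trans H _; rewrite /laplacian -/p1 -/p2 /f.
rewrite le_eqVlt; apply/orP; left; apply/eqP.
ring.
Qed.

End LocalEstimate.

(** On the compact square all functions are integrable and the correction [l * D] integrates to
    zero; on the rest of [U] the pointwise inequality suffices. Over [U] itself the integrals may be
    infinite and are split by nonnegativity. *)
Lemma le_integral_null_mean (R : realType) (s c l : R) (U : set (R * R))
    (m E V D : R * R -> R) :
  open U -> square s `<=` U ->
  (forall p, U p -> {for p, continuous m}) ->
  (forall p, U p -> {for p, continuous E}) ->
  (forall p, U p -> {for p, continuous V}) ->
  (forall p, U p -> 0 <= m p) -> (forall p, U p -> 0 <= E p) ->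
  (forall p, U p -> 0 <= V p) -> 0 <= c -> null_mean s D ->
  (forall p, square s p -> c * m p <= (E p + V p) + l * D p) ->
  (forall p, U p -> ~ square s p -> c * m p <= E p + V p) ->
  (c%:E * \int[area R]_(p in U) (m p)%:E <=
   \int[area R]_(p in U) (E p)%:E + \int[area R]_(p in U) (V p)%:E)%E.
Proof.
move=> oU sU cm cE cV m0 E0 V0 c0 nD hs hU.
have mU := open_plane_measurable oU; have ms := @measurable_square R s.
have mf (f : R * R -> R) : (forall p, U p -> {for p, continuous f}) ->
    forall S : set (measurableTypeR R * measurableTypeR R), S `<=` U -> measurable S ->
    measurable_fun S (EFin \o f).
  move=> cf S SU mS; apply/measurable_EFinP.
  by apply: continuous_plane_measurable => // p /SU; exact: cf.
have ccm p : U p -> {for p, continuous (fun p => c * m p)}.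
  by move=> Up; apply: continuousM; [exact: cvg_cst|exact: cm].
have cEV p : U p -> {for p, continuous (fun p => E p + V p)}.
  by move=> Up; apply: continuousD; [exact: cE|exact: cV].
rewrite -ge0_integralZl_EFin//; last exact: mf.
under eq_integral do rewrite -EFinM.
rewrite -ge0_integralD//; [|exact: mf..].
under [leRHS]eq_integral do rewrite -EFinD.
have mUs : measurable (U `\` square s : set (measurableTypeR R * measurableTypeR R)).
  exact: measurableD.
have split (f : R * R -> R) : (forall p, U p -> {for p, continuous f}) ->
    (forall p, U p -> 0 <= f p) ->
    (\int[area R]_(p in U) (f p)%:E = \int[area R]_(p in square s) (f p)%:E +
      \int[area R]_(p in U `\` square s) (f p)%:E)%E.
  move=> cf f0; rewrite -[in LHS](setDUK sU) ge0_integral_setU//.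
  - by rewrite (setDUK sU); apply: mf.
  - by rewrite (setDUK sU) => p Up; rewrite lee_fin f0.
  - by apply/disj_setPS => p [sp [_]].
rewrite (split _ ccm); last by move=> p Up; rewrite mulr_ge0// m0.
rewrite (split _ cEV); last by move=> p Up; rewrite addr_ge0 ?E0 ?V0.
apply: leeD.
  have is_ (f : R * R -> R) : (forall p, U p -> {for p, continuous f}) ->
      (area R).-integrable (square s : set (measurableTypeR R * measurableTypeR R)) (EFin \o f).
    by move=> cf; apply: integrable_square => p /sU; exact: cf.
  have [cD D0] := nD.
  rewrite -[leRHS]adde0 -[X in (_ <= _ + X)%E](mule0 l%:E) -D0.
  rewrite -integralZl//; last exact: integrable_square cD.
  rewrite -integralD//=; last 2 first.
  - exact: is_ cEV.
  - by apply: integrableZl => //; exact: integrable_square cD.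
  apply: le_integral => //.
  - exact: is_ ccm.
  - apply: integrableD => //; first exact: is_ cEV.
    by apply: integrableZl => //; exact: integrable_square cD.
  - by move=> p /set_mem sp; rewrite -EFinM -EFinD lee_fin hs.
apply: ge0_le_integral => //.
- by move=> p [Up _]; rewrite lee_fin mulr_ge0// m0.
- by apply: mf => // p [].
- by apply: mf => // p [].
- by move=> p [Up sp]; rewrite lee_fin hU.
Qed.

(** * Choice of the constants and the estimate on the disc *)

Theorem proposition3p1 (R : realType) (d : nat) :
  exists C : R, 0 < C /\
  forall B : R, 0 < B ->
  exists c : R, 0 < c /\
  forall (P : {poly R[i]}) (A : R) (phi : R * R -> R),
    size P = d.+1 ->
    (forall z : R[i], root P z -> cabs z < 2^-1) ->
    A = cabs (lead_coef P) ->
    C <= A ->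
    Cclosed 2 phi ->
    (forall p : R * R, disc R p ->
       B^-1 * cabs P.[zeta p] ^+ 2 <= laplacian phi p <=
       B * cabs P.[zeta p] ^+ 2) ->
  forall w : R * R -> R[i],
    Cclosed_complex 1 w ->
    ((c * powR A (2 / d.+1%:R))%:E *
       \int[area R]_(p in disc R) (cabs (w p) ^+ 2 * expR (- 2 * phi p))%:E
     <=
     \int[area R]_(p in disc R)
        (cabs (dbar w p) ^+ 2 * expR (- 2 * phi p))%:E
     + \int[area R]_(p in disc R)
        (laplacian phi p * cabs (w p) ^+ 2 * expR (- 2 * phi p))%:E)%E.
Proof.
have [M ME M0] : exists2 M : R, M = d%:R * pi & 0 <= M.
  by exists (d%:R * pi) => //; rewrite mulr_ge0// pi_ge0.
have M1 : 0 < 1 + 8 * (100 * M) by lra.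
(* With [k^(d+1) = A] this forces [k >= 1] and [8 * 100 * M <= k], which is the absorption condition
   [64 M^2 <= k^2 / 100^2]. *)
exists ((1 + 8 * (100 * M)) ^+ d.+1); split; first exact: exprn_gt0.
move=> B B0; pose eps : R := (10^-1 ^+ d) ^+ 2.
have eps0 : 0 < eps by rewrite !exprn_gt0.
pose K := B + 36 * M ^+ 2 + (8 * M ^+ 2 + 1) * B / eps.
(* This part of [K] alone handles the points outside the square. *)
have K1 : B / eps <= K.
  have : 0 <= 8 * M ^+ 2 * (B / eps).
    by rewrite mulr_ge0 ?divr_ge0 ?(ltW eps0) ?(ltW B0)// mulr_ge0// sqr_ge0.
  have -> : K = B + 36 * M ^+ 2 + 8 * M ^+ 2 * (B / eps) + B / eps.
    by rewrite /K; field; rewrite gt_eqF.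
  by have := sqr_ge0 M; lra.
have K0 : 0 < K by apply: lt_le_trans K1; rewrite divr_gt0.
exists (100^-1 ^+ 2 / 8 / K); split.
  by rewrite !divr_gt0// exprn_gt0// invr_gt0.
have pw : forall x : R, 0 <= x -> 100^-1 ^+ 2 / 8 * x <= x.
  move=> x x0; have : (100^-1 : R) ^+ 2 <= 1 by rewrite expr_le1 ?invr_ge0// invf_le1// ler1n.
  nra.
move=> P A phi sP hroot AE CA phiC2 hphi w wC1.
have A0 : 0 <= A by rewrite AE cabs_ge0.
pose k := powR A (d.+1%:R^-1).
have k0 : 0 <= k by exact: powR_ge0.
have kA : k ^+ d.+1 = A.
  by rewrite -powR_mulrn// -powRrM mulVf ?powRr1// pnatr_eq0.
have lamE : powR A (2 / d.+1%:R) = k ^+ 2.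
  by rewrite mulrC powRrM powR_mulrn.
have kC : 1 + 8 * (100 * M) <= k.
  rewrite leNgt; apply/negP => kC; move: CA; apply/negP; rewrite -ltNge -kA.
  by rewrite ltr_pXn2r// nnegrE//; lra.
(* The roots with multiplicity, so [r] has length [d]. *)
have [r PE] := closed_field_poly_normal P.
have P0 : lead_coef P != 0 by rewrite lead_coef_eq0 -size_poly_eq0 sP.
have sr : size r = d.
  by apply/eqP; rewrite -eqSS -sP [in X in _ == X]PE size_scale// size_prod_XsubC.
have hr z : z \in r -> cabs z < 2^-1.
  by move=> zr; apply: hroot; rewrite PE rootZ// root_prod_XsubC.
have hL q : disc R q -> B^-1 * cabs P.[zeta q] ^+ 2 <= laplacian phi q.
  by move=> /hphi /andP[].
have hM : 64 * M ^+ 2 <= k ^+ 2 * 100^-1 ^+ 2.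
  rewrite exprVn ler_pdivlMr ?exprn_gt0//.
  rewrite (_ : 64 * M ^+ 2 * 100 ^+ 2 = (8 * (100 * M)) ^+ 2); last by ring.
  by rewrite ler_pXn2r ?nnegrE//; lra.
have := @local_estimate R phi w phiC2 wC1 P r k B PE hr.
rewrite sr -ME -/eps -/K -AE kA => /(_ _ erefl B0 hL hM) [|D [nD hD]]; first lra.
rewrite lamE.
pose m q := cabs (w q) ^+ 2 * expR (- 2 * phi q).
have [phi1 phi2 phi3] := Cclosed2_C1_on phiC2.
have [/Cclosed1_C1_on uC1 /Cclosed1_C1_on vC1] := wC1.
have m0 q : 0 <= m q by rewrite mulr_ge0 ?sqr_ge0 ?expR_ge0.
have L0 q : disc R q -> 0 <= laplacian phi q.
  by move=> dq; apply: le_trans (hL q dq); rewrite mulr_ge0 ?invr_ge0 ?sqr_ge0// ltW.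
have ce p : disc R p -> {for p, continuous (fun q => expR (- 2 * phi q))}.
  move=> dp; have [cphi _ _ _ _] := phi1 p dp.
  apply: (@continuous_comp _ _ _ (fun q => - 2 * phi q) expR); last exact: continuous_expR.
  by apply: continuousM; [exact: cvg_cst|exact: cphi].
have cw p : disc R p -> {for p, continuous (fun q => cabs (w q) ^+ 2)}.
  move=> dp; have [cu _ _ _ _] := uC1 p dp; have [cv _ _ _ _] := vC1 p dp.
  have -> : (fun q => cabs (w q) ^+ 2) =
      (fun q => repart w q * repart w q + impart w q * impart w q).
    by apply/funext => q; rewrite sqr_cabs !expr2.
  by apply: continuousD; apply: continuousM.
have cL p : disc R p -> {for p, continuous (laplacian phi)}.
  move=> dp; have [_ c1 _ _ _] := phi2 p dp; have [_ _ c2 _ _] := phi3 p dp.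
  rewrite (_ : laplacian phi = fun q => dx (dx phi) q + dy (dy phi) q) //.
  exact: (continuousD c1 c2).
apply: (@le_integral_null_mean R (7 / 10) _ K^-1 (disc R) m _ _ D).
- exact: disc_open.
- by apply: square_sub_disc; lra.
- by move=> p dp; apply: continuousM; [exact: cw|exact: ce].
- move=> p dp; apply: continuousM; last exact: ce.
  have [_ c1 c2 _ _] := uC1 p dp; have [_ c3 c4 _ _] := vC1 p dp.
  have c5 : {for p, continuous (fun=> 4^-1 : R)} by exact: cvg_cst.
  rewrite (_ : (fun q => cabs (dbar w q) ^+ 2) = (fun q =>
    ((dx (repart w) q - dy (impart w) q) * (dx (repart w) q - dy (impart w) q) +
     (dx (impart w) q + dy (repart w) q) * (dx (impart w) q + dy (repart w) q)) * 4^-1)).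
    have d1 := continuousB c1 c4; have d2 := continuousD c3 c2.
    exact: (continuousM (continuousD (continuousM d1 d1) (continuousM d2 d2)) c5).
  by apply/funext => q; rewrite sqr_cabs_dbar !expr2.
- move=> p dp; apply: continuousM; last exact: ce.
  by apply: continuousM; [exact: cL|exact: cw].
- by move=> p _; exact: m0.
- by move=> p _; rewrite mulr_ge0 ?sqr_ge0 ?expR_ge0.
- move=> p dp; apply: mulr_ge0 (expR_ge0 _).
  exact: mulr_ge0 (L0 _ dp) (sqr_ge0 _).
- by apply: mulr_ge0 (sqr_ge0 _); apply: divr_ge0 (ltW K0); apply: divr_ge0 (sqr_ge0 _) _.
- exact: nD.
- move=> p sp; have := hD p sp; rewrite -/(m p) -[laplacian phi p * _ * _]mulrA -/(m p).
  set V := laplacian phi p * m p; set E := cabs (dbar w p) ^+ 2 * _ => h.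
  rewrite -(ler_pM2l K0).
  rewrite [leLHS](_ : _ = k ^+ 2 * 100^-1 ^+ 2 / 8 * m p); last by field; rewrite gt_eqF.
  by rewrite [leRHS](_ : _ = D p + K * (V + E)) //; field; rewrite gt_eqF.
(* Outside the square no integration by parts is involved: some coordinate exceeds 3/5, so
   [k^2 * eps <= |P|^2] is at most [B] times the Laplacian of [phi], and the Laplacian term alone
   dominates. *)
- move=> p dp nsp.
  rewrite -[laplacian phi p * _ * _]mulrA -/(m p).
  have far : 3 / 5 <= `|p.1| \/ 3 / 5 <= `|p.2|.
    have [h1|h1] := leP (3 / 5) `|p.1|; first by left.
    have [h2|h2] := leP (3 / 5) `|p.2|; first by right.
    exfalso; apply: nsp; move: h1 h2; rewrite !ltr_norml => /andP[? ?] /andP[? ?].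
    by split; rewrite /= in_itv/=; apply/andP; split; lra.
  have hP := cabs_away_ge PE hr far; rewrite -AE -kA sr in hP.
  have kk : k <= k ^+ d.+1 by rewrite exprS ler_peMr ?exprn_ege1//; lra.
  have lQ : k * 10^-1 ^+ d <= cabs P.[zeta p].
    by apply: le_trans hP; rewrite ler_wpM2r// exprn_ge0// invr_ge0.
  have kQ : k ^+ 2 * eps <= B * laplacian phi p.
    apply: (@le_trans _ _ (cabs P.[zeta p] ^+ 2)).
      by rewrite -exprMn ler_pXn2r// nnegrE ?cabs_ge0// mulr_ge0.
    by rewrite -ler_pdivrMl//; exact: hL.
  have V0 : 0 <= laplacian phi p * m p by rewrite mulr_ge0// L0.
  have E0 : 0 <= cabs (dbar w p) ^+ 2 * expR (- 2 * phi p).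
    by rewrite mulr_ge0 ?sqr_ge0 ?expR_ge0.
  apply: (@le_trans _ _ (laplacian phi p * m p)); last by rewrite lerDr.
  rewrite -(ler_pM2l K0).
  rewrite [leLHS](_ : _ = 100^-1 ^+ 2 / 8 * (k ^+ 2 * m p)); last by field; rewrite gt_eqF.
  apply: le_trans (pw _ (mulr_ge0 (sqr_ge0 _) (m0 _))) _.
  apply: (@le_trans _ _ (B / eps * (laplacian phi p * m p))); last by rewrite ler_wpM2r.
  by rewrite mulrA ler_wpM2r// mulrAC ler_pdivlMr.
Qed.
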